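(* For $h\geq 1$ let $L_h=\sum_{W}p_h^U(W)\,|W|$ be the expected length of a growing self-avoiding walk on $\mathcal G_h$ starting at $(0,h-1)$ under the uniform model, the sum being over all GSAWs on $\mathcal G_h$ starting at $(0,h-1)$. Then $$L_3=\frac{486414801}{25317287},$$ $$L_4=\frac{36398762646457399797278201924184927631185786219507599165631529}{1584271961568506676402164217848452838298247680057676502545715},$$ and $L_5$ is a rational number whose value rounded to 10 decimal places is $26.5182848508$.
   Context: $\mathcal G_h$ is the half-infinite grid graph with vertex set $\mathbb N\times\{0,\dots,h-1\}$ ($0\in\mathbb N$), with an edge between two points exactly when they are at Euclidean distance $1$. A growing self-avoiding walk (GSAW) is a finite directed walk that visits no vertex twice and whose final vertex is trapped, i.e. all of its neighbors are visited by the walk. $|W|$ is the number of edges of $W$. Uniform model: at each step the next vertex is chosen uniformly at random among the not-yet-visited neighbors of the current endpoint; $p_h^U(W)$ is the product over the steps of $W$ of $1/m$, where $m$ is the number of unvisited neighbors of the current endpoint just before that step. *)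

(* Defs.v *)
From mathcomp Require Import all_boot all_order all_algebra.
From mathcomp Require Import zify.
From mathcomp Require Import all_classical all_reals all_analysis.

Set Implicit Arguments.
Unset Strict Implicit.
Unset Printing Implicit Defensive.

Import Order.TTheory GRing.Theory Num.Theory.
Local Open Scope classical_set_scope.
Local Open Scope ring_scope.

Definition vertex (h : nat) : choiceType := (nat * 'I_h)%type.

Definition sqdist h (u v : vertex h) : int :=
  (u.1%:Z - v.1%:Z) ^+ 2 + ((u.2 : nat)%:Z - (v.2 : nat)%:Z) ^+ 2.

(* Euclidean distance 1, tested on the squared distance; see adjP. *)
Definition adj h : rel (vertex h) := fun u v => sqdist u v == 1.

Lemma adjP (R : realType) h (u v : vertex h) :
  adj u v <->
  Num.sqrt ((u.1%:R - v.1%:R) ^+ 2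
            + ((u.2 : nat)%:R - (v.2 : nat)%:R) ^+ 2) = 1 :> R.
Proof.
set d : R := _ + _.
have dE : d = (sqdist u v)%:~R by rewrite /sqdist rmorphD /= !rmorphXn /= !rmorphB.
have d0 : 0 <= d by rewrite addr_ge0 ?sqr_ge0.
rewrite /adj; split=> [/eqP uv|d1]; first by rewrite dE uv sqrtr1.
by rewrite -(eqr_int R) -dE -(sqr_sqrtr d0) d1 expr1n.
Qed.

(* All neighbors of v lie in columns 0, ..., v.1 + 1; see mem_neighbors. *)
Definition neighbors h (v : vertex h) : seq (vertex h) :=
  [seq u <- [seq (x, y) : vertex h | x <- iota 0 v.1.+2, y <- enum 'I_h]
  | adj v u].

Lemma neighbors_uniq h (v : vertex h) : uniq (neighbors v).
Proof.
apply/filter_uniq/allpairs_uniq; rewrite ?iota_uniq ?enum_uniq //.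
by move=> [? ?] [? ?] _ _ [-> ->].
Qed.

Lemma mem_neighbors h (v u : vertex h) : (u \in neighbors v) = adj v u.
Proof.
rewrite mem_filter andb_idr // => /eqP uv.
have ux : (u.1 < v.1.+2)%N by move: uv; rewrite /sqdist; nia.
apply/allpairsP; exists (u.1, u.2).
by rewrite mem_iota mem_enum add0n; split=> //; case: (u).
Qed.

(* The walk (v0, [:: v1; ...; vn]) visits v0, v1, ..., vn in this order. *)
Definition walk (h : nat) : choiceType := (vertex h * seq (vertex h))%type.

Definition visits h (W : walk h) : seq (vertex h) := W.1 :: W.2.

Definition endpoint h (W : walk h) : vertex h := last W.1 W.2.

(* Number of edges of W. *)
Definition len h (W : walk h) : nat := size W.2.

Definition trapped h (W : walk h) : Prop :=
  forall u, adj (endpoint W) u -> u \in visits W.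

Definition gsaw h (W : walk h) : Prop :=
  [/\ path (@adj h) W.1 W.2, uniq (visits W) & trapped W].

(* The first i steps of W. *)
Definition prefix_walk h (W : walk h) (i : nat) : walk h := (W.1, take i W.2).

Definition unvisited h (W : walk h) : nat :=
  count (fun u => u \notin visits W) (neighbors (endpoint W)).

Definition pU (R : realType) h (W : walk h) : R :=
  \prod_(i < len W) (unvisited (prefix_walk W i))%:R^-1.

(* GSAWs starting at (0, h - 1); for h = 0 there are no vertices at all. *)
Definition corner_gsaws (h : nat) : set (walk h) :=
  [set W | [/\ gsaw W, W.1.1 = 0%N & W.1.2 = h.-1 :> nat]].
Arguments corner_gsaws : clear implicits.

Definition L (R : realType) (h : nat) : \bar R :=
  \esum_(W in corner_gsaws h) (pU R W * (len W)%:R)%:E.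

(* Rounding to n decimal places (half up). *)
Definition round_dec (n : nat) (x : rat) : rat :=
  (Num.floor (x * 10 ^+ n + 1 / 2))%:~R / 10 ^+ n.

(* Main.v *)
Require Import Defs.
From Stdlib Require Import BinNat Nnat Pnat.
From mathcomp Require Import all_boot all_order all_algebra.
From mathcomp Require Import zify ring lra.
From mathcomp Require Import all_classical all_reals all_analysis.

Set Implicit Arguments.
Unset Strict Implicit.
Unset Printing Implicit Defensive.

Import Order.TTheory GRing.Theory Num.Theory.
Local Open Scope ring_scope.

(* L_h + 1 is the sum of the probabilities of all self-avoiding walks from the
   corner, hence the limit over c of the sum S_c over the walks that stay in the
   first c columns.  Cut the strip behind column c: the columns up to c and the
   other ones interact only through a word that records, in order, the visits of
   column c, the steps to the right and the steps back.  Weighting walks by a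
   function of that word, the insertion of one more column is a linear operator
   T on functions of words, which does not depend on c, and S_(c+1) is a fixed
   linear form applied to T^c X_0.  Only finitely many words occur.  A positive
   function Y with T Y <= (9/10) Y on the words with a step to the right makes
   T^c X_0 converge geometrically to the fixed point X of T.  For h = 3, 4 the
   fixed point is given explicitly; for h = 5 it is rational, because Y also
   shows that the linear system is nonsingular over the rationals, and an
   approximate fixed point encloses the value of the linear form. *)

(** * The protocol of a strip at its last column *)

(* Seen from the right of a last column c: [Stay b r] is a visit of (c, r) that
   does not continue to the right, where b says whether (c + 1, r) is unvisited
   at that moment; [Cross r] is a visit of (c, r) followed by a step to
   (c + 1, r); [Enter r] is a step from (c + 1, r) to (c, r), after which the
   walk cannot return to the right at once.  A leaf (d, w) stands for a
   behaviour of probability 1/d with protocol w. *)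

(** The expected length is the sum over n >= 1 of the probability of reaching n steps, and n = 0
    supplies the extra 1; the boundary term of this summation by parts vanishes because survival
    probabilities decrease and are summable. The obstacle to cutting the strip is that the factor
    1/m of a step depends on what is visited on both sides of the cut at that moment. It is removed
    by guessing: at a vertex of the cut column the left part lists behaviours for each possible
    state of the right neighbour, and the right part has a behaviour only for the true guess. Each
    factor 1/m is then charged to the side where the step starts. The letters of a word belong to
    distinct vertices of one column, so its length is at most h. On words without a crossing the
    columns on the right are never entered: X is 1 there and Y is 0, and a contraction is required
    only on the remaining words. The tables of X and Y are untrusted data; only the inequalities
    verified by computation in binary integers enter the proof. *)

Inductive letter := Stay of bool & nat | Cross of nat | Enter of nat.
Definition word := seq letter.
Definition leaf := (N * word)%type.

Definition without (T : eqType) (U : seq T) (u : T) := [seq x <- U | x != u].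

Definition extend (m : nat) (l : word) (p : leaf) : leaf :=
  ((N.of_nat m * p.1)%num, l ++ p.2).

(* The behaviours of a walk in a set of vertices whose last column is [bd], and
   which is bounded on the left by further columns.  [U] is the list of unvisited
   vertices, [v] the endpoint (not in U), [f] says whether the walk has already
   been to the right of [bd] (before that, every right neighbour is unvisited),
   and [ent] whether it has just come from there.  [stop] says whether the walk
   may end, [free v] whether the left neighbour of v is unvisited, and [back]
   lists the behaviours after a step to the left.  The fuel [n] must exceed the
   size of U. *)
Section Game.
Variables (T : eqType) (adj : rel T) (bd : pred T) (row : T -> nat).
Variables (stop : bool) (free : pred T) (back : T -> bool -> seq T -> seq leaf).

Definition stops (w : word) : seq leaf := if stop then [:: (1%num, w)] else [::].

(** Each entry is a guess about the right neighbour: the letter announces it, and the boolean says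
    whether that neighbour counts in m. Wrong guesses are not excluded here; [column] gives them no
    behaviour. *)
Definition labels (f ent : bool) (v : T) : seq (word * bool) :=
  if ~~ bd v then [:: ([::], false)]
  else if ent then [:: ([:: Enter (row v)], false)]
  else (if f then [:: ([:: Stay false (row v)], false)] else [::])
       ++ [:: ([:: Stay true (row v)], true)].

(** A return is listed at every unvisited boundary vertex and without a factor: where it happens,
    and with which probability, is decided by the columns on the right. *)
Definition outside (rec : seq T -> T -> bool -> bool -> seq leaf) (U : seq T) :=
  stops [::] ++ flatten [seq rec (without U u) u true true | u <- U & bd u].

(** The factor 1/m belongs to the part in which a step starts, so a step to the right carries one.
    Its letter [Cross] replaces the [Stay true] of the same visit. *)
Fixpoint game n U v (f ent : bool) : seq leaf :=
  if n is n'.+1 then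
    let nb := [seq u <- U | adj v u] in
    flatten [seq
      let m := (size nb + free v + l.2)%N in
      stops l.1
      ++ map (extend m l.1)
           (flatten [seq game n' (without U u) u f false | u <- nb] ++ back v f U)
      ++ (if l.2 then map (extend m [:: Cross (row v)]) (outside (game n') U)
          else [::])
    | l : word * bool <- labels f ent v]
  else [::].
End Game.

Definition row_adj (r q : nat) := (q == r.+1) || (r == q.+1).

(* The behaviours of a new column whose vertices in the rows U are unvisited, given
   the protocol w of the columns on its left, the last of which has the unvisited
   rows [a].  A word that does not fit the new column has no behaviour. *)
Fixpoint column (w : word) (a U : seq nat) (f : bool) {struct w} : seq leaf :=
  match w with
  | [::] => [:: (1%num, [::])]
  | Stay b r :: w1 =>
      if (r \in U) == b then column w1 (without a r) U f else [::]
  | Cross r :: w1 =>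
      if r \in U then
        let a' := without a r in
        game row_adj predT id (nilp w1) (mem a')
          (fun v f U => if w1 is Enter q :: w2 then
             if (q == v) && (v \in a') then column w2 (without a' v) U f else [::]
             else [::])
          (size U) (without U r) r f false
      else [::]
  | Enter _ :: _ => [::]
  end.

Definition column_leaves h w := column w (iota 0 h) (iota 0 h) false.
(* The walk enters the corner as if it came from a column without any unvisited
   vertex. *)
Definition start_leaves h := column [:: Cross h.-1] [::] (iota 0 h) false.

Definition crossfree (w : word) :=
  all (fun l => if l is Stay true _ then true else false) w.

(** * Weighted sums over behaviours *)

Lemma nat_of_binE n : nat_of_bin n = N.to_nat n.
Proof.
case: n => //=; elim=> //= p ->.
  by rewrite Pos2Nat.inj_xI NatTrec.doubleE -mul2n.
by rewrite Pos2Nat.inj_xO NatTrec.doubleE -mul2n.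
Qed.

Lemma nat_of_mul_bin (m n : N) : (m * n)%num = (m * n)%N :> nat.
Proof. by rewrite !nat_of_binE N2Nat.inj_mul. Qed.

Section Ev.
Variable F : numFieldType.
Implicit Types (X : word -> F) (s : seq leaf).

Definition ev X s : F := \sum_(p <- s) X p.2 / (nat_of_bin p.1)%:R.

Lemma ev_cat X s1 s2 : ev X (s1 ++ s2) = ev X s1 + ev X s2.
Proof. exact: big_cat. Qed.

Lemma ev_nil X : ev X [::] = 0.
Proof. exact: big_nil. Qed.

Lemma ev_leaf X w : ev X [:: (1%num, w)] = X w.
Proof. by rewrite /ev big_seq1 /= divr1. Qed.

Lemma ev_flatten (I : Type) X (E : I -> seq leaf) r :
  ev X (flatten [seq E i | i <- r]) = \sum_(i <- r) ev X (E i).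
Proof. by rewrite /ev big_flatten big_map. Qed.

(** Valid for m = 0 as well, where both sides are 0 because 0^-1 = 0; this is the case of a trapped
    endpoint. *)
Lemma ev_extend X m l s :
  ev X (map (extend m l) s) = m%:R^-1 * ev (fun w => X (l ++ w)) s.
Proof.
rewrite /ev big_map mulr_sumr; apply: eq_bigr => p _ /=.
rewrite nat_of_mul_bin [nat_of_bin (N.of_nat m)]nat_of_binE Nat2N.id natrM invfM.
by rewrite mulrCA.
Qed.

Lemma eq_ev X X' s : X =1 X' -> ev X s = ev X' s.
Proof. by move=> eqX; apply: eq_bigr => p _; rewrite eqX. Qed.

Lemma ev0 s : ev (fun=> 0) s = 0.
Proof. by rewrite /ev big1 // => p _; rewrite mul0r. Qed.

Lemma evD X X' s : ev (fun w => X w + X' w) s = ev X s + ev X' s.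
Proof. by rewrite /ev -big_split; apply: eq_bigr => p _; rewrite mulrDl. Qed.

Lemma evZ c X s : ev (fun w => c * X w) s = c * ev X s.
Proof. by rewrite /ev mulr_sumr; apply: eq_bigr => p _; rewrite mulrA. Qed.

Lemma ev_sum (I : Type) (r : seq I) (P : pred I) (Y : I -> word -> F) s :
  ev (fun w => \sum_(i <- r | P i) Y i w) s = \sum_(i <- r | P i) ev (Y i) s.
Proof.
rewrite /ev exchange_big; apply: eq_bigr => p _ /=.
by rewrite mulr_suml.
Qed.

Section GameEv.
Variables (T : eqType) (adj : rel T) (bd : pred T) (row : T -> nat).
Variables (stop : bool) (free : pred T) (back : T -> bool -> seq T -> seq leaf).
Notation game := (game adj bd row stop free back).

Lemma ev_stops X w : ev X (stops stop w) = stop%:R * X w.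
Proof. by case: stop; rewrite /= ?ev_leaf ?ev_nil ?mul1r ?mul0r. Qed.

Lemma ev_outside X rec (U : seq T) :
  ev X (outside bd stop rec U) =
  stop%:R * X [::] + \sum_(u <- U | bd u) ev X (rec (without U u) u true true).
Proof. by rewrite ev_cat ev_stops ev_flatten big_filter. Qed.

Lemma ev_game X n U v f ent :
  let m b := (size [seq u <- U | adj v u] + free v + nat_of_bool b)%:R in
  ev X (game n.+1 U v f ent) =
  \sum_(l <- labels bd row f ent v)
    (stop%:R * X l.1
     + (m l.2)^-1 *
       (\sum_(u <- U | adj v u)
          ev (fun w => X (l.1 ++ w)) (game n (without U u) u f false)
        + ev (fun w => X (l.1 ++ w)) (back v f U))
     + l.2%:R * ((m l.2)^-1 *
          ev (fun w => X (Cross (row v) :: w)) (outside bd stop (game n) U))).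
Proof.
move=> m; rewrite /= ev_flatten; apply: eq_bigr => -[w b] _ /=; rewrite -addrA.
have cat3 Y s1 s2 s3 : ev Y (s1 ++ s2 ++ s3) = ev Y s1 + (ev Y s2 + ev Y s3).
  by rewrite !ev_cat.
rewrite cat3 ev_stops ev_extend.
have -> Y s1 s2 : ev Y (s1 ++ s2) = ev Y s1 + ev Y s2 by exact: ev_cat.
rewrite ev_flatten big_filter; congr (_ + (_ + _)).
by case: b; rewrite ?mul0r ?ev_nil // mul1r ev_extend.
Qed.
End GameEv.
End Ev.

(** * Adding a column *)

Lemma adjE h (u v : vertex h) :
  adj u v = (u.1 == v.1) && row_adj u.2 v.2 || (u.2 == v.2) && row_adj u.1 v.1.
Proof.
rewrite /adj /sqdist /row_adj -[u.2 == v.2]val_eqE /=.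
move: u v => [x y] [z t] /=; move: (nat_of_ord y) (nat_of_ord t) => {}y {}t.
apply/idP/idP; last by move=> H; apply/eqP; nia.
move/eqP => H.
have : (x%:Z - z%:Z) ^+ 2 <= 1 by nia.
have : (y%:Z - t%:Z) ^+ 2 <= 1 by nia.
move=> Hy Hx; have [a1 a2] : x%:Z - z%:Z <= 1 /\ -1 <= x%:Z - z%:Z by nia.
have [b1 b2] : y%:Z - t%:Z <= 1 /\ -1 <= y%:Z - t%:Z by nia.
nia.
Qed.

Lemma size_without (T : eqType) (U : seq T) u :
  uniq U -> u \in U -> (size (without U u)).+1 = size U.
Proof.
move=> Uu uU; have -> : without U u = rem u U by rewrite rem_filter.
by rewrite size_rem //; case: U uU {Uu}.
Qed.

Lemma mem_without (T : eqType) (U : seq T) u v :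
  (v \in without U u) = (v != u) && (v \in U).
Proof. by rewrite mem_filter. Qed.

Lemma without_uniq (T : eqType) (U : seq T) u : uniq U -> uniq (without U u).
Proof. exact: filter_uniq. Qed.

Lemma without_id (T : eqType) (U : seq T) u : u \notin U -> without U u = U.
Proof.
by move=> uU; apply/all_filterP/allP => v vU; apply: contraNneq uU => <-.
Qed.

(** Names the [back] argument buried in the fixpoint [column], so that the game started by a [Cross]
    can be stated without unfolding that fixpoint. *)
Definition reenter w (a : seq nat) (v : nat) f (U : seq nat) : seq leaf :=
  if w is Enter q :: w2 then
    if (q == v) && (v \in a) then column w2 (without a v) U f else [::]
  else [::].

Definition column_game w a :=
  game row_adj predT id (nilp w) (mem a) (reenter w a).

Lemma column_cross r w a U f : column (Cross r :: w) a U f =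
  if r \in U then column_game w (without a r) (size U) (without U r) r f false
  else [::].
Proof. by []. Qed.

Section Split.
Variables (F : numFieldType) (h : nat).
Implicit Types (X : word -> F) (c : nat) (U : seq (vertex h)) (u v : vertex h).

Definition left_game c :=
  game (@adj h) (fun v => v.1.+1 == c) (fun v => v.2 : nat) true pred0
    (fun _ _ _ => [::]).

Definition left_outside c n U :=
  outside (fun v => v.1.+1 == c) true (left_game c n) U.

Definition before c U := [seq v <- U | (v.1 < c)%N].
Definition rows c U := [seq (v.2 : nat) | v <- U & v.1 == c].
Definition last_rows c U := [seq (v.2 : nat) | v <- U & v.1.+1 == c].

Lemma mem_rows c U v : v.1 = c -> (v.2 : nat) \in rows c U = (v \in U).
Proof.
move=> vc; apply/mapP/idP => [[[x y]]|vU].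
  rewrite mem_filter /= => /andP[/eqP xc xU] vy.
  suff -> : v = (x, y) by [].
  by case: v vc vy => ? ? /= -> /val_inj ->; rewrite xc.
by exists v; rewrite // mem_filter vc eqxx.
Qed.

Lemma mem_last_rows c U v :
  v.1.+1 = c -> (v.2 : nat) \in last_rows c U = (v \in U).
Proof. by move=> <-; exact: mem_rows. Qed.

Lemma rows_without c U u :
  u.1 = c -> rows c (without U u) = without (rows c U) u.2.
Proof.
move=> uc; rewrite /rows /without filter_map -!filter_predI; congr map.
apply: eq_filter => v /=; case: eqP => vc; rewrite ?andbT ?andbF //; congr (~~ _).
by case: u v uc vc => [? a] [? b] /= -> ->; rewrite xpair_eqE eqxx.
Qed.

Lemma rows_without_id c U u : u.1 != c -> rows c (without U u) = rows c U.
Proof.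
move=> uc; rewrite /rows /without -!filter_predI; congr map.
apply: eq_filter => v /=; case: eqP => vc; rewrite ?andbT ?andbF //.
by apply: contraNneq uc => <-; rewrite vc.
Qed.

Lemma last_rows_without c U u :
  u.1.+1 = c -> last_rows c (without U u) = without (last_rows c U) u.2.
Proof. by move=> <-; exact: rows_without. Qed.

Lemma last_rows_without_id c U u :
  u.1.+1 != c -> last_rows c (without U u) = last_rows c U.
Proof. by case: c => [|c] uc; [rewrite /last_rows !filter_pred0|exact: rows_without_id]. Qed.

Lemma before_without c U u :
  before c (without U u) = without (before c U) u.
Proof. by rewrite /before /without -!filter_predI; apply: eq_filter => v /=; rewrite andbC. Qed.

Lemma before_without_id c U u :
  (c <= u.1)%N -> before c (without U u) = before c U.
Proof.
by move=> uc; rewrite before_without without_id // mem_filter ltnNge uc.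
Qed.

(** A walk that has just come from the right has [Enter] as its only label, so all its words begin
    with that letter. *)
Lemma ev_enter c n U v f X X' : v.1.+1 == c ->
  (forall w, X (Enter v.2 :: w) = X' (Enter v.2 :: w)) ->
  ev X (left_game c n U v f true) = ev X' (left_game c n U v f true).
Proof.
move=> vc eqX; case: n => [|n]; first by rewrite !ev_nil.
rewrite !ev_game /labels vc !big_seq1 /= !mul0r !addr0 eqX.
congr (_ + _ * (_ + _)); last exact: eq_ev.
by apply: eq_bigr => u _; apply: eq_ev.
Qed.

(** The walk that never returns is the only behaviour with the empty word, and it has weight 1;
    every other one begins with [Enter]. This turns the condition [nilp w] for ending in a new
    column into the unconditional end of the longer strip. *)
Lemma ev_outside_nil c n U (x : F) :
  ev (fun w => (nilp w)%:R * x) (left_outside c n U) = x.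
Proof.
rewrite ev_outside /= !mul1r big1 ?addr0 // => u uc.
rewrite (@ev_enter _ _ _ _ _ _ (fun=> 0)) ?ev0.
- by [].
- exact: uc.
- by move=> w; rewrite mul0r.
Qed.

Lemma split_columns c U (P : pred (vertex h)) (G : vertex h -> F) :
  {in U, forall u, (u.1 <= c)%N} ->
  \sum_(u <- U | P u) G u =
  \sum_(u <- before c U | P u) G u + \sum_(u <- U | (u.1 == c) && P u) G u.
Proof.
move=> Uc; rewrite (bigID (fun u => (u.1 < c)%N)) /= big_filter_cond; congr (_ + _).
  by apply: eq_bigl => u; rewrite andbC.
rewrite big_seq_cond [RHS]big_seq_cond; apply: eq_bigl => u.
by case uU: (u \in U) => //=; have := Uc _ uU; rewrite -leqNgt [_ == c]eqn_leq andbC => ->.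
Qed.

Lemma sum_rows c U (P : pred nat) (G : nat -> F) :
  \sum_(q <- rows c U | P q) G q =
  \sum_(u <- U | (u.1 == c) && P u.2) G u.2.
Proof. by rewrite big_map big_filter_cond. Qed.
End Split.

(** * Splitting a strip into its last column and the columns before it *)

Section Compose.
Variables (F : numFieldType) (h : nat).
Implicit Types (c : nat) (X : word -> F) (U : seq (vertex h)) (u v : vertex h).

Definition column_value X a b f : word -> F := fun w => ev X (column w a b f).

Lemma column_value_nil X a b f : column_value X a b f [::] = X [::].
Proof. exact: ev_leaf. Qed.

Definition enter_value X a b f : word -> F := fun w =>
  if w is Enter _ :: w2 then column_value X a b f w2 else 0.

Definition column_game_value X a b r f ent : word -> F := fun w =>
  ev X (column_game w a (size b).+1 b r f ent).

Definition game_at c U := @left_game h c (size U).+1 U.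

(* In the next three statements the columns before c + 1 are split into those before
   c and column c.  The endpoint v is in the left part, has just stepped back
   from column c into it, or is in column c, respectively. *)
Definition left_token c U := forall X v a f f0, (v.1 < c)%N -> v \notin U ->
  last_rows c U = (if v.1.+1 == c then without a (v.2 : nat) else a) ->
  (~~ f0 -> forall r : 'I_h, (r : nat) \in rows c U) ->
  ev X (game_at c.+1 U v f false) =
  ev (column_value X a (rows c U) f) (game_at c (before c U) v f0 false).

Definition back_token c U := forall X v f, v.1.+1 = c -> v \notin U ->
  (v.2 : nat) \notin rows c U ->
  ev X (game_at c.+1 U v f false) =
  ev (enter_value X (last_rows c U) (rows c U) f)
     (game_at c (before c U) v true true).

Definition right_token c U := forall X v f ent, v.1 = c -> v \notin U ->
  ev X (game_at c.+1 U v f ent) =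
  ev (column_game_value X (last_rows c U) (rows c U) v.2 f ent)
     (left_outside c (size (before c U)) (before c U)).

Lemma count_before c U (P : pred (vertex h)) :
  {in U, forall u, (u.1 <= c)%N} ->
  count P U = (count P (before c U) + count (fun u => (u.1 == c) && P u) U)%N.
Proof.
elim: U => //= u U IH Uc; rewrite IH => [|w wU]; last by apply: Uc; rewrite inE wU orbT.
have := Uc u; rewrite inE eqxx => /(_ isT).
by case: ltngtP => //= _ _; lia.
Qed.

Lemma adj_next c v u : (v.1 < c)%N -> (u.1 == c) && adj v u =
  (v.1.+1 == c) && (u == (c, v.2)).
Proof.
case: u v => [x y] [z t] /= zc; rewrite adjE /row_adj /= xpair_eqE [t == y]eq_sym -[y == t]val_eqE /=.
by lia.
Qed.

Lemma adj_before c U v : uniq U -> (v.1 < c)%N ->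
  {in U, forall u, (u.1 <= c)%N} ->
  size [seq u <- U | adj v u] =
    (size [seq u <- before c U | adj v u]
     + ((v.1.+1 == c) && ((v.2 : nat) \in rows c U)))%N.
Proof.
move=> Uu vc Uc; rewrite !size_filter (count_before _ Uc); congr (_ + _)%N.
rewrite (eq_count (fun u => adj_next u vc)); case: eqP => [vc1|]; last by rewrite count_pred0.
by rewrite (@mem_rows _ c U (c, v.2)) // -count_uniq_mem.
Qed.

Lemma ev_left_game c U v f X :
  uniq U -> {in U, forall u, (u.1 <= c)%N} -> (v.1 < c)%N ->
  ev X (game_at c.+1 U v f false) =
  X [::] + (size [seq u <- before c U | adj v u]
     + ((v.1.+1 == c) && ((v.2 : nat) \in rows c U)))%:R^-1 *
   (\sum_(u <- before c U | adj v u) ev X (game_at c.+1 (without U u) u f false)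
    + \sum_(u <- U | (u.1 == c) && adj v u)
         ev X (game_at c.+1 (without U u) u f false)).
Proof.
move=> Uu Uc vc.
have vc1 : (v.1.+1 == c.+1) = false by lia.
rewrite [LHS]ev_game /labels vc1 big_seq1 /= !addn0 (adj_before Uu vc Uc) !mul0r !addr0 mul1r.
rewrite ev_nil addr0 -split_columns //; congr (_ + _ * _).
rewrite big_seq_cond [RHS]big_seq_cond; apply: eq_bigr => u /andP[uU _].
by rewrite /game_at size_without.
Qed.

Lemma big_at c U v (G : vertex h -> F) : uniq U -> (v.1 < c)%N ->
  \sum_(u <- U | (u.1 == c) && adj v u) G u =
  ((v.1.+1 == c) && ((v.2 : nat) \in rows c U))%:R * G (c, v.2).
Proof.
move=> Uu vc; rewrite (eq_bigl _ _ (fun u => adj_next u vc)).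
case: eqP => vc1 /=; last by rewrite big_pred0_eq mul0r.
rewrite (@mem_rows _ c U (c, v.2)) //; case: (boolP (_ \in _)) => uU.
  by rewrite -big_filter filter_pred1_uniq // big_seq1 mul1r.
rewrite mul0r big_seq_cond big_pred0 // => u.
by apply/andP => -[uU' /eqP uE]; rewrite uE in uU'; rewrite uU' in uU.
Qed.

Section Step.
Variables (c : nat) (U : seq (vertex h)).
Hypotheses (Uu : uniq U) (Uc : {in U, forall u, (u.1 <= c)%N}).
Hypothesis IH : {in U, forall u,
  [/\ left_token c (without U u), back_token c (without U u) & right_token c (without U u)]}.

Let beforeP u : u \in before c U -> (u.1 < c)%N /\ u \in U.
Proof. by rewrite mem_filter => /andP. Qed.

Let before_uniq : uniq (before c U).
Proof. exact: filter_uniq. Qed.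

Let size_before u : u \in before c U ->
  size (before c U) = (size (without (before c U) u)).+1.
Proof. by move=> uU; rewrite size_without. Qed.

Lemma step_left X f f0 u : 
  (~~ f0 -> forall r : 'I_h, (r : nat) \in rows c U) ->
  u \in before c U ->
  ev (column_value X (last_rows c U) (rows c U) f)
    (@left_game h c (size (before c U)) (without (before c U) u) u f0 false)
  = ev X (game_at c.+1 (without U u) u f false).
Proof.
move=> full ub; have [uc uU] := beforeP ub; have [left_u _ _] := IH uU.
have uc' : u.1 != c by rewrite neq_ltn uc.
rewrite (left_u _ _ (last_rows c U) _ f0) ?mem_without ?eqxx //.
- by rewrite /game_at before_without -size_before // rows_without_id.
- case: eqP => [uc1|/eqP uc1]; first by rewrite last_rows_without.
  by rewrite last_rows_without_id.
- by move=> f0F r; rewrite rows_without_id ?full.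
Qed.

(** The right neighbour has been visited, so neither side counts it in m, and the letter [Enter]
    makes [enter_value] continue as [column_value]. *)
Lemma step_back_token : back_token c U.
Proof.
move=> X v f vc1 vU vr; have vc : (v.1 < c)%N by rewrite -vc1.
have bd : v.1.+1 == c by rewrite vc1.
rewrite ev_left_game // bd (negbTE vr) [RHS]ev_game /labels bd big_seq1 /=.
rewrite !mul0r !addr0 !addn0 mul1r ev_nil addr0 column_value_nil.
rewrite big_at // (negbTE vr) andbF mul0r addr0.
congr (_ + _ * _); rewrite big_seq_cond [RHS]big_seq_cond.
apply: eq_bigr => u /andP[ub _].
by rewrite -(@step_left _ _ true).
Qed.

(** Away from the cut the two recursions agree term by term. At the cut, the left game offers the
    guesses [Stay false] and [Stay true], and exactly the one that agrees with column c has a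
    nonzero value. If column c has not been visited, the single guess [Stay true] is the right
    one. *)
Lemma step_left_token : left_token c U.
Proof.
move=> X v a f f0 vc vU aE full; rewrite ev_left_game // big_at //.
case: (boolP (v.1.+1 == c)) aE => vc1 aE /=; last first.
  rewrite [RHS]ev_game /labels vc1 big_seq1 /=.
  rewrite !mul0r !addr0 !addn0 mul1r ev_nil addr0 column_value_nil -aE.
  congr (_ + _ * _); rewrite big_seq_cond [RHS]big_seq_cond.
  by apply: eq_bigr => u /andP[ub _]; rewrite -(@step_left _ _ f0).
set t := _ \in _; set r := (v.2 : nat).
(* [E b] is the contribution of the label [Stay b], including its [Cross] variant; [EP] shows that
   it is the whole left-hand side when b is the true state t of the right neighbour, and 0
   otherwise. *)
pose E b : F := 1 * column_value X a (rows c U) f [:: Stay b r]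
  + (size [seq u <- before c U | adj v u] + 0 + nat_of_bool b)%:R^-1
    * (\sum_(u <- before c U | adj v u)
         ev (fun w => column_value X a (rows c U) f ([:: Stay b r] ++ w))
           (@left_game h c (size (before c U)) (without (before c U) u) u f0 false)
       + ev (fun w => column_value X a (rows c U) f ([:: Stay b r] ++ w)) [::])
  + b%:R * ((size [seq u <- before c U | adj v u] + 0 + nat_of_bool b)%:R^-1
    * ev (fun w => column_value X a (rows c U) f (Cross r :: w))
         (left_outside c (size (before c U)) (before c U))).
have EP b : E b = (t == b)%:R * (X [::] + (size [seq u <- before c U | adj v u] + t)%:R^-1 *
   (\sum_(u <- before c U | adj v u) ev X (game_at c.+1 (without U u) u f false)
    + t%:R * ev X (game_at c.+1 (without U (c, v.2)) (c, v.2) f false))).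
  rewrite /E /column_value /= -/t; case: (eqVneq t b) => [<-|tb]; last first.
    rewrite !ev_nil mulr0 addr0 (eq_bigr (fun=> 0)) => [|u _]; last by rewrite ev0.
    rewrite big1_eq mulr0 add0r mul0r; case: b tb => tb; last by rewrite mul0r addr0.
    have tF : t = false by case: (t) tb.
    rewrite (@eq_ev _ _ (fun=> 0)) ?ev0 ?mulr0 ?addr0 // => w.
    by rewrite -/t tF ev_nil.
  rewrite !mul1r ev_nil addr0 ev_leaf addn0 -addrA; congr (_ + _).
  rewrite [X in _ + X]mulrCA -mulrDr -aE; congr (_ * (_ + _)).
    rewrite big_seq_cond [RHS]big_seq_cond.
    by apply: eq_bigr => u /andP[ub _]; rewrite -(@step_left _ _ f0).
  case tT: t; last by rewrite !mul0r.
  rewrite !mul1r.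
  have uU : (c, v.2) \in U by rewrite -(@mem_rows _ c U (c, v.2)).
  have [_ _ right_u] := IH uU.
  rewrite right_u ?mem_without ?eqxx // before_without_id //.
  rewrite last_rows_without_id ?rows_without //=; last by rewrite neq_ltn ltnSn orbT.
  apply: eq_ev => w; rewrite /column_game_value size_without //.
  by rewrite map_inj_in_uniq ?filter_uniq // => -[x1 y1] [x2 y2]; rewrite !mem_filter
    => /andP[/= /eqP -> _] /andP[/= /eqP -> _] /val_inj ->.
transitivity (\sum_(l <- labels (fun v : vertex h => v.1.+1 == c) (fun v => v.2 : nat) f0 false v) E l.2).
  clearbody E; rewrite /labels vc1 /=; case: f0 full => /= full.
    rewrite !big_cons big_nil !EP; case: (t); rewrite !eqxx !mul1r ?mul0r ?add0r ?addr0 //.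
  rewrite big_seq1 EP; have -> : t = true by exact: full.
  by rewrite !mul1r.
rewrite [RHS]ev_game /labels vc1 /E {E EP}; case: f0 full => _ /=.
  by rewrite !big_cons !big_nil.
by rewrite !big_seq1.
Qed.

Lemma adj_same v u : v.1 = c -> (u.1 == c) && adj v u =
  (u.1 == c) && row_adj v.2 u.2.
Proof.
by move=> <-; rewrite adjE [v.1 == _]eq_sym /row_adj; case: eqP => // ->; lia.
Qed.

Lemma adj_prev v u : v.1 = c ->
  (u.1 < c)%N && adj v u = (u.1.+1 == c) && ((u.2 : nat) == v.2).
Proof.
by move=> <-; rewrite adjE /row_adj [v.2 == u.2]eq_sym -[u.2 == _]val_eqE /=; lia.
Qed.

Lemma size_adj v : v.1 = c -> size [seq u <- U | adj v u] =
  (size [seq q <- rows c U | row_adj v.2 q] + ((v.2 : nat) \in last_rows c U))%N.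
Proof.
move=> vc; rewrite !size_filter (count_before _ Uc) addnC; congr (_ + _)%N.
  rewrite count_map count_filter; apply: eq_count => u /=.
  by rewrite adj_same // andbC.
rewrite count_filter (eq_count (a2 := fun u => (u.1.+1 == c) && ((u.2 : nat) == v.2))); last first.
  by move=> u /=; rewrite andbC adj_prev.
case: (posnP c) => [c0|]; first by rewrite c0 /last_rows filter_pred0 /= count_pred0.
case: (c) => // c' _.
rewrite (@mem_last_rows _ _ U (c', v.2)) // -count_uniq_mem //.
Qed.

Lemma rows_uniq : uniq (rows c U).
Proof.
rewrite map_inj_in_uniq ?filter_uniq // => -[x1 y1] [x2 y2].
by rewrite !mem_filter => /andP[/= /eqP -> _] /andP[/= /eqP -> _] /val_inj ->.
Qed.

Lemma step_column X f ent u : u.1 = c -> u \in U ->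
  ev X (@left_game h c.+1 (size U) (without U u) u f ent) =
  ev (fun w => ev X (column_game w (last_rows c U) (size (rows c U)) (without (rows c U) u.2) u.2 f ent))
     (left_outside c (size (before c U)) (before c U)).
Proof.
move=> uc uU; have [_ _ right_u] := IH uU.
have := right_u X u f ent uc; rewrite mem_without eqxx => /(_ isT).
rewrite /game_at /column_game_value size_without //.
rewrite before_without_id ?uc // last_rows_without_id ?uc; last by rewrite neq_ltn ltnSn orbT.
rewrite rows_without // => ->; apply: eq_ev => w.
by rewrite size_without ?rows_uniq // mem_rows.
Qed.

(** While the walk is to the right of column c, the left part is suspended with a remaining word w.
    The walk may end there exactly when w is empty, and it can only return through column c. *)
Lemma step_outside X :
  ev X (left_outside c.+1 (size U) U) =
  ev (fun w => ev X (outside predT (nilp w) (column_game w (last_rows c U) (size (rows c U))) (rows c U)))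
     (left_outside c (size (before c U)) (before c U)).
Proof.
rewrite ev_outside mul1r; under [RHS]eq_ev do rewrite ev_outside.
rewrite evD ev_outside_nil ev_sum sum_rows; congr (_ + _).
rewrite big_seq_cond [RHS]big_seq_cond.
apply: eq_big => [u|u /andP[uU /eqP[uc]]]; first by rewrite eqSS andbT.
exact: step_column.
Qed.

(** The only neighbour in the previous column lies in the same row. The left part offers re-entries
    in all rows, and [reenter] rejects the others. *)
Lemma step_back X v f : v.1 = c -> v \notin U ->
  \sum_(u <- before c U | adj v u)
     ev X (@left_game h c.+1 (size U) (without U u) u f false) =
  ev (fun w => ev X (reenter w (last_rows c U) v.2 f (rows c U)))
     (left_outside c (size (before c U)) (before c U)).
Proof.
move=> vc vU; rewrite ev_outside /= ev_nil mulr0 add0r.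
rewrite (bigID (fun u => (u.2 : nat) == v.2) (fun u => u.1.+1 == c)) /=.
rewrite [X in _ + X]big1 ?addr0 => [|u /andP[uc ur]]; last first.
  rewrite (@ev_enter _ _ _ _ _ _ _ _ (fun=> 0)) ?ev0 // => w /=.
  by rewrite (negbTE ur) ev_nil.
rewrite big_seq_cond [RHS]big_seq_cond; apply: eq_big => [u|u].
  by case ub: (u \in _) => //=; rewrite -adj_prev // (beforeP ub).1.
move=> /andP[ub vu]; have [uc uU] := beforeP ub.
have /andP[/eqP uc1 /eqP ur] : (u.1.+1 == c) && ((u.2 : nat) == v.2).
  by rewrite -adj_prev // uc.
have [_ back_u _] := IH uU.
have uc' : u.1 != c by rewrite neq_ltn uc.
have := back_u X u f uc1; rewrite mem_without eqxx => /(_ isT).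
rewrite rows_without_id // ur mem_rows // => /(_ vU).
rewrite /game_at size_without // => ->.
rewrite before_without -size_before // last_rows_without // ur.
apply: ev_enter => [|w]; first by rewrite uc1.
by rewrite /= /column_value ur eqxx -ur mem_last_rows // uU.
Qed.

Lemma step_right_token : right_token c U.
Proof.
move=> X v f ent vc vU; rewrite [LHS]ev_game /column_game_value /column_game.
under [RHS]eq_ev do rewrite ev_game.
have -> : labels (fun v : vertex h => v.1.+1 == c.+1) (fun v => v.2 : nat) f ent v
    = labels predT id f ent (v.2 : nat) by rewrite /labels vc eqxx.
rewrite ev_sum; apply: eq_bigr => -[l b] _ /=.
rewrite size_adj // addn0 !evD !evZ !evD ev_sum ev_outside_nil mul1r ev_nil addr0.
rewrite -step_outside -step_back // (split_columns _ _ Uc) sum_rows.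
congr (_ + _ * _ + _); rewrite addrC; congr (_ + _).
rewrite big_seq_cond [RHS]big_seq_cond; apply: eq_big => [u|u].
  by rewrite adj_same.
by move=> /and3P[uU /eqP uc _]; exact: step_column.
Qed.
End Step.

(** The three statements call each other, since a step can change the side of the cut; each step
    consumes a vertex, so they are proved together by induction on the number of unvisited
    vertices. *)
Lemma compose_columns c U : uniq U -> {in U, forall u, (u.1 <= c)%N} ->
  [/\ left_token c U, back_token c U & right_token c U].
Proof.
have [n] := ubnP (size U); elim: n U => // n IHn U Un Uu Uc.
have IH : {in U, forall u,
    [/\ left_token c (without U u), back_token c (without U u) & right_token c (without U u)]}.
  move=> u uU; apply: IHn; first by rewrite -ltnS size_without.
    exact: without_uniq.
  by move=> v; rewrite mem_without => /andP[_ /Uc].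
by split; [exact: step_left_token|exact: step_back_token|exact: step_right_token].
Qed.
End Compose.

(** * Strips starting from the corner *)

Definition transfer (F : numFieldType) h (X : word -> F) : word -> F :=
  fun w => ev X (column_leaves h w).

(* The right neighbours of the last column are unvisited and never entered. *)
Definition closed_env (F : numFieldType) (w : word) : F := (crossfree w)%:R.

Section Grid.
Variable (k : nat).
Notation h := k.+1.
Implicit Types (c : nat) (v : vertex h).

Definition grid c : seq (vertex h) := [seq (x, y) | x <- iota 0 c, y <- enum 'I_h].
Definition corner : vertex h := (0%N, ord_max).

Lemma mem_grid c v : (v \in grid c) = (v.1 < c)%N.
Proof.
case: v => x y; apply/allpairsP/idP => [[[a b]] [/=]|xc].
  by rewrite mem_iota add0n => ac _ [-> _].
by exists (x, y); split; rewrite ?mem_iota ?mem_enum.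
Qed.

Lemma grid_uniq c : uniq (grid c).
Proof.
by apply: allpairs_uniq; rewrite ?iota_uniq ?enum_uniq // => -[? ?] [? ?] _ _ [-> ->].
Qed.

Lemma gridS c : grid c.+1 = grid c ++ [seq (c, y) | y <- enum 'I_h].
Proof. by rewrite /grid -[c.+1]addn1 iotaD allpairs_cat add0n /= cats0. Qed.

Lemma rows_grid x c : (x < c)%N -> rows x (grid c) = iota 0 h.
Proof.
elim: c => // c IHc; rewrite ltnS leq_eqVlt gridS /rows filter_cat map_cat.
move=> /predU1P[->|xc].
  rewrite (eq_in_filter (a2 := pred0)) ?filter_pred0 => [|v]; last first.
    by rewrite mem_grid; case: ltngtP.
  rewrite cat0s filter_map -map_comp (eq_filter (a2 := predT)) ?filter_predT.
    by rewrite -val_enum_ord; apply: eq_map.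
  by move=> y /=; rewrite eqxx.
rewrite -/(rows _ _) IHc // filter_map (eq_filter (a2 := pred0)) ?filter_pred0 ?cats0 //.
by move=> y /=; apply/negbTE; rewrite neq_ltn xc orbT.
Qed.

Lemma before_grid c : before c (grid c.+1) = grid c.
Proof.
rewrite gridS /before filter_cat (eq_in_filter (a2 := predT)) => [|v]; last first.
  by rewrite mem_grid.
rewrite filter_predT filter_map (eq_filter (a2 := pred0)) ?filter_pred0 ?cats0 //.
by move=> y /=; rewrite ltnn.
Qed.

Section Transfer.
Variable F : numFieldType.
Implicit Types X : word -> F.

Definition strip_value c X :=
  ev X (game_at c (without (grid c) corner) corner false false).

Let start_uniq c : uniq (without (grid c.+1) corner).
Proof. exact/without_uniq/grid_uniq. Qed.

Let start_cols c : {in without (grid c.+1) corner, forall u, (u.1 <= c)%N}.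
Proof. by move=> u; rewrite mem_without mem_grid => /andP[]. Qed.

Lemma strip_valueS c X : (0 < c)%N ->
  strip_value c.+1 X = strip_value c (transfer h X).
Proof.
move=> c0; have [+ _ _] := compose_columns F (@start_uniq c) (@start_cols c).
move=> /(_ X corner (iota 0 h) false false).
have cE : corner.1 != c by rewrite neq_ltn c0.
rewrite rows_without_id ?rows_grid // before_without before_grid.
rewrite c0 mem_without eqxx => /(_ isT isT) step; apply: step; last first.
  by move=> _ r; rewrite mem_iota add0n ltn_ord.
(* The rows [a] are all of [iota 0 h] even if the corner lies in the last column of the left part:
   the first letter of the word, emitted at the corner, removes it. *)
case: c c0 {cE} => // c _; case: eqP => [c1|/eqP c1].
  by rewrite last_rows_without // [last_rows _ _]rows_grid.
by rewrite last_rows_without_id // [last_rows _ _]rows_grid.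
Qed.

(** Before column 0 there is nothing, and the only behaviour of nothing is the empty word. What
    remains is the game of one column entered at the corner. *)
Lemma strip_value1 X : strip_value 1 X = ev X (start_leaves h).
Proof.
have [_ _ +] := compose_columns F (@start_uniq 0) (@start_cols 0).
move=> /(_ X corner false false); rewrite mem_without eqxx => /(_ erefl erefl).
rewrite /strip_value => ->.
rewrite rows_without // rows_grid // /last_rows (eq_filter (a2 := pred0)) //.
rewrite filter_pred0 /before (eq_filter (a2 := pred0)) // filter_pred0.
have -> : left_outside 0 (size ([::] : seq (vertex h))) [::] = [:: (1%num, [::])] by [].
rewrite ev_leaf /column_game_value size_without ?iota_uniq //; last first.
  by rewrite mem_iota add0n /=.
rewrite /start_leaves column_cross.
have -> : h.-1 \in iota 0 h by rewrite mem_iota add0n /=.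
by [].
Qed.

Lemma strip_value_iter c X :
  strip_value c.+1 X = ev (iter c (transfer h) X) (start_leaves h).
Proof.
elim: c X => [|c IHc] X; first exact: strip_value1.
by rewrite strip_valueS // IHc iterSr.
Qed.
End Transfer.
End Grid.

(** * Self-avoiding walks and the expected length *)

Section Walks.
Variable (k : nat).
Notation h := k.+1.
Implicit Types (W : walk h) (u v : vertex h) (c n : nat).

Definition add_step W u : walk h := (W.1, rcons W.2 u).
Definition next_steps W := [seq u <- neighbors (endpoint W) | u \notin visits W].
Fixpoint saws n : seq (walk h) :=
  if n is n'.+1 then [seq add_step W u | W <- saws n', u <- next_steps W]
  else [:: (corner k, [::])].

Lemma size_next_steps W : size (next_steps W) = unvisited W.
Proof. by rewrite size_filter. Qed.

Lemma endpoint_add W u : endpoint (add_step W u) = u.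
Proof. exact: last_rcons. Qed.

Lemma visits_add W u : visits (add_step W u) = rcons (visits W) u.
Proof. by rewrite /visits rcons_cons. Qed.

Lemma mem_saws n W : W \in saws n <->
  [/\ W.1 = corner k, size W.2 = n, path (@adj h) W.1 W.2 & uniq (visits W)].
Proof.
elim: n W => [|n IHn] W.
  rewrite inE; split=> [/eqP ->//|[]].
  by case: W => a [|b s] //= ->.
split=> [/allpairsPdep[V [u [/IHn[V1 V2 V3 V4]]]]|].
  rewrite mem_filter mem_neighbors => /andP[uV Vu] ->; split=> //.
  - by rewrite size_rcons V2.
  - by rewrite rcons_path V3.
  - by rewrite visits_add rcons_uniq uV.
case: W => a s [a0 sn sp su]; rewrite /= in a0 sn sp.
case: (lastP s) sn sp su => [//|t u]; rewrite size_rcons => -[tn].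
have -> : visits (a, rcons t u) = rcons (a :: t) u by [].
rewrite rcons_path rcons_uniq => /andP[tp tu] /andP[ut Ut].
apply/allpairsPdep; exists (a, t), u; split => //; first exact/IHn.
by rewrite mem_filter mem_neighbors ut.
Qed.

Lemma saws_uniq n : uniq (saws n).
Proof.
elim: n => //= n IHn; apply: allpairs_uniq_dep => //.
  by move=> W _; apply/filter_uniq/neighbors_uniq.
move=> [[a s] u] [[b t] v] _ _ /= [->] /eqP; rewrite eqseq_rcons.
by move=> /andP[/eqP -> /eqP ->].
Qed.

Section Weights.
Variable R : realType.

Lemma pU_add W u : pU R (add_step W u) = pU R W / (unvisited W)%:R.
Proof.
rewrite /pU /len /= size_rcons big_ord_recr /=; congr (_ * _).
  apply: eq_bigr => i _; rewrite /prefix_walk /= -cats1 take_cat ltn_ord //.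
by rewrite /prefix_walk /= -cats1 take_size_cat; case: W.
Qed.

Definition survive n : R := \sum_(W <- saws n) pU R W.
Definition trap n : R := \sum_(W <- saws n | unvisited W == 0%N) pU R W.

Lemma pU_ge0 W : 0 <= pU R W.
Proof. by apply: prodr_ge0 => i _; rewrite invr_ge0. Qed.

Lemma survive_ge0 n : 0 <= survive n.
Proof. by apply: sumr_ge0 => W _; exact: pU_ge0. Qed.

Lemma big_sawsS n (P : pred (walk h)) (G : walk h -> R) :
  \sum_(W <- saws n.+1 | P W) G W =
  \sum_(W <- saws n) \sum_(u <- next_steps W | P (add_step W u)) G (add_step W u).
Proof. by rewrite /= big_mkcond big_allpairs_dep; apply: eq_bigr => W _; rewrite -big_mkcond. Qed.

Lemma survive0 : survive 0 = 1.
Proof. by rewrite /survive big_seq1 /pU /= big_ord0. Qed.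

(** A walk with m > 0 unvisited neighbours distributes its whole weight over m extensions; only the
    weight of trapped walks is lost. *)
Lemma surviveS n : survive n.+1 = survive n - trap n.
Proof.
rewrite /survive big_sawsS /trap (bigID (fun W => unvisited W == 0%N) predT) /= addrC.
rewrite [X in X - _](bigID (fun W => unvisited W == 0%N) predT) /= addrAC subrr add0r.
rewrite [X in _ + X]big1 ?addr0 => [|W /eqP]; last first.
  by rewrite -size_next_steps => /size0nil ->; rewrite big_nil.
apply: eq_bigr => W uW; under eq_bigr do rewrite pU_add.
rewrite big_const_seq count_predT size_next_steps iter_addr_0 -[LHS]mulr_natr divfK //.
by rewrite pnatr_eq0.
Qed.
End Weights.
End Walks.

(** * Walks confined to the first columns *)

Section Inside.
Variables (R : realType) (k : nat).
Notation h := k.+1.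
Implicit Types (W : walk h) (u v : vertex h) (c n : nat).

Definition inside c W := all (fun v => (v.1 < c)%N) (visits W).
Definition free_in c W := [seq v <- grid k c | v \notin visits W].
Local Notation closed_env := (closed_env R).
(** The total weight, relative to that of W, of all continuations of W inside the first c columns, W
    itself included. The flag [f] is false since such walks never go beyond the last column. *)
Definition inside_value c W :=
  ev closed_env (game_at c (free_in c W) (endpoint W) false false).

Lemma inside_add c W u :
  inside c (add_step W u) = inside c W && (u.1 < c)%N.
Proof. by rewrite /inside visits_add all_rcons andbC. Qed.

Lemma endpoint_visits W : endpoint W \in visits W.
Proof. exact: mem_last. Qed.

Lemma endpoint_inside c W : inside c W -> ((endpoint W).1 < c)%N.
Proof. by move/allP => /(_ _ (endpoint_visits W)). Qed.

Lemma free_in_add c W u : free_in c (add_step W u) = without (free_in c W) u.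
Proof.
rewrite /free_in /without -filter_predI; apply: eq_filter => v /=.
by rewrite visits_add mem_rcons inE negb_or.
Qed.

Lemma free_in_uniq c W : uniq (free_in c W).
Proof. exact/filter_uniq/grid_uniq. Qed.

Lemma mem_next_steps W u :
  (u \in next_steps W) = (u \notin visits W) && adj (endpoint W) u.
Proof. by rewrite mem_filter mem_neighbors. Qed.

Lemma mem_free_in c W u :
  (u \in free_in c W) = (u \notin visits W) && (u.1 < c)%N.
Proof. by rewrite mem_filter mem_grid. Qed.

Lemma perm_free c W :
  perm_eq [seq u <- free_in c W | adj (endpoint W) u]
          [seq u <- next_steps W | (u.1 < c)%N].
Proof.
apply: uniq_perm; [exact/filter_uniq/free_in_uniq| |].
  exact/filter_uniq/filter_uniq/neighbors_uniq.
move=> u; rewrite mem_filter mem_free_in [RHS]mem_filter mem_next_steps.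
by case: (adj _ _); case: (_ < c)%N; case: (_ \notin _).
Qed.

(** A confined walk has not visited column c, so at an endpoint in column c - 1 the right neighbour
    always counts as unvisited, just as the label [Stay true] assumes. *)
Lemma unvisited_inside c W : inside c W ->
  unvisited W = (size [seq u <- free_in c W | adj (endpoint W) u]
                 + ((endpoint W).1.+1 == c))%N.
Proof.
move=> Wc; have ec := endpoint_inside Wc.
rewrite (perm_size (perm_free c W)) -size_next_steps.
rewrite -(count_predC (fun u => (u.1 < c)%N) (next_steps W)) size_filter.
congr (_ + _)%N.
rewrite count_filter; set e := endpoint W.
rewrite (eq_in_count (a2 := fun u => (e.1.+1 == c) && (u == (c, e.2)))) => [|u].
  case: eqP => [e1|_]; last by rewrite count_pred0.
  rewrite -/(pred1 _) count_uniq_mem ?neighbors_uniq // mem_neighbors -/e.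
  by rewrite adjE /row_adj /= eqxx e1 eqxx /= orbT.
rewrite mem_neighbors /= -leqNgt -/e => eu.
have -> : (c <= u.1)%N && (u \notin visits W) = (c <= u.1)%N.
  case: leqP => //= cu; apply: contraL cu => /(allP Wc) /=.
  by rewrite ltnNge.
move: eu ec; rewrite -/e adjE /row_adj; case: (e) (u) => x y [z t] /=.
rewrite xpair_eqE [t == y]eq_sym; case: (y =P t) => _ /=; lia.
Qed.

Lemma inside_value_step c W : inside c W ->
  inside_value c W = 1 + (unvisited W)%:R^-1 *
    \sum_(u <- next_steps W | (u.1 < c)%N) inside_value c (add_step W u).
Proof.
move=> Wc; rewrite (unvisited_inside Wc) -big_filter -(perm_big _ (perm_free c W)) big_filter.
rewrite /inside_value [LHS]ev_game.
set U := free_in c W; set e := endpoint W.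
have sumE : \sum_(u <- U | adj e u) ev closed_env (@left_game h c (size U) (without U u) u false false)
  = \sum_(u <- U | adj e u) ev closed_env
       (game_at c (free_in c (add_step W u)) (endpoint (add_step W u)) false false).
  rewrite big_seq_cond [RHS]big_seq_cond; apply: eq_bigr => u /andP[uU _].
  by rewrite /game_at endpoint_add free_in_add size_without // free_in_uniq.
rewrite -sumE /labels; case: (boolP (e.1.+1 == c)) => ec; rewrite big_seq1 /= ?ev_nil ?addr0 ?addn0.
  (* At the last column the step to the right counts in the denominator, but [closed_env] gives it
     weight 0. *)
  rewrite (@eq_ev _ (fun w => closed_env (Cross e.2 :: w)) (fun=> 0)) //.
  by rewrite ev0 !mulr0 addr0 mulr1.
by rewrite !mul0r addr0 mulr1.
Qed.

Lemma inside_value_corner c : (0 < c)%N ->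
  inside_value c (corner k, [::]) = strip_value k c closed_env.
Proof.
move=> c0; rewrite /inside_value /strip_value; congr (ev _ (game_at _ _ _ _ _)).
by apply: eq_filter => v; rewrite /visits /= inE.
Qed.

Definition inside_sum c n : R := \sum_(W <- saws k n | inside c W) pU R W.

Lemma inside_sum_step c n :
  \sum_(W <- saws k n | inside c W) pU R W * inside_value c W =
  inside_sum c n
  + \sum_(W <- saws k n.+1 | inside c W) pU R W * inside_value c W.
Proof.
rewrite big_sawsS /inside_sum.
rewrite [X in _ + X](bigID (inside c)) /= [X in _ + (_ + X)]big1 ?addr0; last first.
  move=> W /negbTE Wc; rewrite big_pred0 // => u.
  by rewrite inside_add Wc.
rewrite -big_split; apply: eq_bigr => W Wc /=.
rewrite inside_value_step // mulrDr mulr1 mulrA mulr_sumr; congr (_ + _).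
apply: eq_big => [u|u _]; first by rewrite inside_add Wc.
by rewrite pU_add.
Qed.

Lemma inside_size c W : inside c W -> uniq (visits W) ->
  (size (visits W) <= size (grid k c))%N.
Proof.
by move=> /allP Wc /uniq_leq_size; apply=> v /Wc; rewrite mem_grid.
Qed.

(** Unrolling the recursion n times leaves a remainder over walks with n + 1 distinct vertices in
    the grid, and there are none once n reaches the number of vertices. *)
Lemma strip_value_sum c n : (0 < c)%N -> (size (grid k c) <= n)%N ->
  strip_value k c closed_env = \sum_(i < n) inside_sum c i.
Proof.
move=> c0 cn; rewrite -inside_value_corner //.
have -> : inside_value c (corner k, [::]) =
    \sum_(i < n) inside_sum c i
    + \sum_(W <- saws k n | inside c W) pU R W * inside_value c W.
  elim: n {cn} => [|n IHn]; last by rewrite IHn inside_sum_step big_ord_recr addrA.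
  rewrite big_ord0 add0r big_mkcond big_seq1 /inside /= c0 /= /pU big_ord0 mul1r.
  by [].
rewrite [X in _ + X]big1_seq ?addr0 // => W /andP[Wc /mem_saws[_ Wn _ Wu]].
by have := leq_trans (inside_size Wc Wu) cn; rewrite /= Wn ltnn.
Qed.

Lemma inside_sum_le c n : inside_sum c n <= survive k R n.
Proof.
rewrite /survive (bigID (inside c)) /= lerDl; apply: sumr_ge0 => W _; exact: pU_ge0.
Qed.

Lemma path_inside n W : W \in saws k n -> inside n.+1 W.
Proof.
elim: n W => [|n IHn] W; first by rewrite inE => /eqP ->.
move=> /allpairsPdep[V [u [/IHn Vn]]].
rewrite mem_filter mem_neighbors adjE => /andP[_ Vu] ->; rewrite inside_add.
apply/andP; split; first by apply: sub_all Vn => v /ltnW.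
have := endpoint_inside Vn; move: Vu; rewrite /row_adj; lia.
Qed.

Lemma inside_sum_eq c n : (n < c)%N -> inside_sum c n = survive k R n.
Proof.
move=> nc; rewrite /survive (bigID (inside c)) /= [X in _ + X]big1_seq ?addr0 //.
move=> W /andP[Wc /path_inside Wn]; case/negP: Wc.
by apply: sub_all Wn => v; rewrite ltnS => /leq_ltn_trans; apply.
Qed.

Definition survivals n : R := \sum_(i < n) survive k R i.

(** A walk of fewer than c steps from column 0 cannot leave the first c columns, so the strip
    contains all of them. *)
Lemma survivals_ge c : (0 < c)%N -> survivals c <= strip_value k c closed_env.
Proof.
move=> c0; rewrite (@strip_value_sum c (maxn c (size (grid k c)))) ?leq_maxr //.
rewrite /survivals (big_ord_widen _ (survive k R) (leq_maxl c (size (grid k c)))).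
rewrite [leRHS](bigID (fun i : 'I_ _ => (i < c)%N)) /=.
rewrite -[leLHS]addr0 lerD ?ler_sum //; first by move=> i ic; rewrite inside_sum_eq.
by apply: sumr_ge0 => i _; apply: sumr_ge0 => W _; exact: pU_ge0.
Qed.

Lemma survivals_le c : (0 < c)%N ->
  exists n, strip_value k c closed_env <= survivals n.
Proof.
move=> c0; exists (size (grid k c)); rewrite (@strip_value_sum c (size (grid k c))) //.
by apply: ler_sum => i _; exact: inside_sum_le.
Qed.
End Inside.

(** * The expected length as a sum of survival probabilities *)

Section ExpectedLength.
Variables (R : realType) (k : nat).
Notation h := k.+1.
Implicit Types (W : walk h) (n N : nat).

Local Notation survive := (survive k R).
Local Notation survivals := (survivals R k).
Local Notation trap := (trap k R).

Definition length_sum N : R := \sum_(i < N) i%:R * trap i.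

Lemma survivalsS n : survivals n.+1 = survivals n + survive n.
Proof. exact: big_ord_recr. Qed.

(** Summation by parts, since [trap i] is [survive i - survive i.+1]. *)
Lemma length_sumS N :
  length_sum N.+1 = survivals N.+1 - 1 - N%:R * survive N.+1.
Proof.
elim: N => [|N IHN].
  rewrite /length_sum /survivals !big_ord1 survive0.
  by rewrite !mul0r subr0 subrr.
rewrite /length_sum big_ord_recr -/(length_sum N.+1) IHN /= (survivalsS N.+1).
have -> : trap N.+1 = survive N.+1 - survive N.+2 by rewrite (surviveS _ _ N.+1); ring.
by rewrite -natr1; ring.
Qed.

Lemma trap_ge0 n : 0 <= trap n.
Proof. by apply: sumr_ge0 => W _; exact: pU_ge0. Qed.

Lemma survive_le n m : (n <= m)%N -> survive m <= survive n.
Proof.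
elim: m => [|m IHm]; first by rewrite leqn0 => /eqP ->.
rewrite leq_eqVlt => /predU1P[-> //|/IHm]; apply: le_trans.
by rewrite surviveS lerBlDr lerDl trap_ge0.
Qed.

Lemma survivals_tail M n : survivals M + n%:R * survive (M + n) <= survivals (M + n).
Proof.
elim: n => [|n IHn]; first by rewrite mul0r addr0 addn0.
rewrite addnS survivalsS -natr1.
have := survive_le (leqnSn (M + n)); have := survive_ge0 k R (M + n).+1.
have : 0 <= n%:R :> R by [].
nra.
Qed.

Section Limit.
Variable S : R.
Hypothesis strip_lim : forall e : R, 0 < e -> exists N, forall n, (N <= n)%N ->
  `|strip_value k n.+1 (closed_env R) - S| <= e.

Lemma survivals_leS n : survivals n <= S.
Proof.
apply/ler_addgt0Pr => e /strip_lim[N HN].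
have := HN _ (leq_maxl N n); set c := maxn N n => Hc.
have := @survivals_ge R k c.+1 isT => H1.
have H2 : survivals n <= survivals c.+1.
  have nc : (n <= c.+1)%N by rewrite leqW ?leq_maxr.
  rewrite -(subnKC nc); apply: le_trans (survivals_tail _ _).
  by rewrite lerDl mulr_ge0 ?survive_ge0.
apply: (le_trans H2); apply: (le_trans H1).
by rewrite -lerBlDl; apply: le_trans Hc; exact: ler_norm.
Qed.

Lemma survivals_geS (e : R) : 0 < e -> exists n, S - e <= survivals n.
Proof.
move=> /strip_lim[N HN]; have [n Hn] := @survivals_le R k N.+1 isT.
exists n; apply: le_trans Hn; rewrite lerBlDr -lerBlDl.
apply: le_trans (HN N (leqnn _)); rewrite distrC; exact: ler_norm.
Qed.

Lemma length_sum_le N : length_sum N <= S - 1.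
Proof.
case: N => [|N].
  rewrite /length_sum big_ord0 subr_ge0; have := survivals_leS 1.
  by rewrite /survivals big_ord1 survive0.
rewrite length_sumS; have := survivals_leS N.+1.
have : 0 <= N%:R * survive N.+1 by rewrite mulr_ge0 ?survive_ge0.
lra.
Qed.

(** The boundary term of [length_sumS] at N = M + n splits in two: its part with factor n is
    absorbed by [survivals_tail], which leaves [survivals M], and its part with the fixed factor M
    becomes small as n grows. *)
Lemma length_sum_ge (e : R) : 0 < e -> exists N, S - 1 - e <= length_sum N.
Proof.
move=> e0; have e20 : 0 < e / 2 by rewrite divr_gt0.
have [M HM] := survivals_geS e20.
have S0 : 0 <= S by apply: le_trans (survivals_leS 0); rewrite /survivals big_ord0.
(* With s the survival probability after M + n + 1 steps, monotonicity gives n * s <= S, hence M * s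
   <= M * S / n, which this choice of n bounds by e / 2. *)
have [n n0 Hn] : exists2 n, (0 < n)%N & M%:R * S <= e / 2 * n%:R.
  exists (Num.bound (M%:R * S / (e / 2))).+1 => //.
  rewrite [leRHS]mulrC -ler_pdivrMr //; apply/ltW/(@lt_trans _ _ (Num.bound (M%:R * S / (e / 2)))%:R).
    by apply: archi_boundP; rewrite divr_ge0 ?mulr_ge0 // ltW.
  by rewrite ltr_nat.
exists (M + n).+1; rewrite length_sumS.
have T1 := survivals_tail M n.+1; have T2 := survivals_tail 0 (M + n).+1.
have T3 := survivals_leS (M + n).+1; rewrite addnS in T1; rewrite add0n in T2.
set s := survive _ in T1 T2 *; have s0 : 0 <= s by exact: survive_ge0.
rewrite [survivals 0]big_ord0 add0r in T2.
have Ms : M%:R * s <= e / 2.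
  have n0' : 0 < n%:R :> R by rewrite ltr0n.
  rewrite -(ler_pM2r n0') -mulrA; apply: le_trans Hn; rewrite ler_wpM2l //.
  apply: le_trans (le_trans T2 T3); rewrite mulrC ler_wpM2r // ler_nat.
  by rewrite leqW // leq_addl.
rewrite -natr1 in T1; rewrite natrD; nra.
Qed.

End Limit.
End ExpectedLength.

(** * The extended sum over all growing self-avoiding walks *)

Section Esum.
Local Open Scope classical_set_scope.
Variables (R : realType) (k : nat).
Notation h := k.+1.
Implicit Types (W : walk h) (n N : nat).

Definition gsaws N : seq (walk h) :=
  flatten [seq [seq W <- saws k i | unvisited W == 0%N] | i <- iota 0 N].

Lemma trappedP W : trapped W <-> unvisited W = 0%N.
Proof.
split=> [Wt|/eqP].
  apply/eqP; rewrite -leqn0 leqNgt -has_count; apply/hasPn => u.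
  by rewrite mem_neighbors negbK => /Wt.
rewrite -leqn0 leqNgt -has_count => /hasPn Wt u.
by rewrite -mem_neighbors => /Wt; rewrite negbK.
Qed.

Lemma gsawsS N :
  gsaws N.+1 = gsaws N ++ [seq W <- saws k N | unvisited W == 0%N].
Proof.
by rewrite /gsaws -[N.+1]addn1 iotaD map_cat flatten_cat /= cats0.
Qed.

Lemma mem_gsaws N W : W \in gsaws N <-> corner_gsaws h W /\ (len W < N)%N.
Proof.
have cE (v : vertex h) : v = corner k <-> v.1 = 0%N /\ v.2 = h.-1 :> nat.
  split=> [->//|]; case: v => x y [/= -> yk].
  by congr (_, _); apply/val_inj.
split=> [/flattenP[s /mapP[i + ->]]|[[[Wp Wu /trappedP Wt] W1 W2] WN]].
  rewrite mem_iota add0n => iN; rewrite mem_filter => /andP[/eqP Wt].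
  move=> /mem_saws[/cE[W1 W2] Wi Wp Wu]; split; last by rewrite /len Wi.
  by split=> //; split=> //; apply/trappedP.
apply/flattenP; exists [seq W <- saws k (len W) | unvisited W == 0%N].
  by apply/mapP; exists (len W); rewrite ?mem_iota.
rewrite mem_filter Wt eqxx; apply/mem_saws; split=> //.
exact/cE.
Qed.

Lemma gsaws_uniq N : uniq (gsaws N).
Proof.
elim: N => // N IHN; rewrite gsawsS cat_uniq IHN filter_uniq ?saws_uniq //= andbT.
apply/hasPn => W; rewrite mem_filter => /andP[_ /mem_saws[_ WN _ _]].
by apply/negP => /mem_gsaws[_]; rewrite /len WN ltnn.
Qed.

Lemma sum_gsaws N :
  \sum_(W <- gsaws N) pU R W * (len W)%:R = length_sum R k N.
Proof.
elim: N => [|N IHN]; first by rewrite /length_sum big_ord0 big_nil.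
rewrite gsawsS big_cat /= IHN /length_sum big_ord_recr; congr (_ + _).
rewrite big_filter mulr_sumr big_seq_cond [RHS]big_seq_cond.
apply: eq_bigr => W /andP[/mem_saws[_ WN _ _] _].
by rewrite /len WN mulrC.
Qed.

Lemma gsaw_term_ge0 W : (0 <= (pU R W * (len W)%:R)%:E)%E.
Proof. by rewrite lee_fin mulr_ge0 ?pU_ge0. Qed.

Lemma fsum_gsaws N :
  (\sum_(W \in [set` gsaws N]) (pU R W * (len W)%:R)%:E)%E = (length_sum R k N)%:E.
Proof. by rewrite -fsbig_seq ?gsaws_uniq // sumEFin sum_gsaws. Qed.

(** The terms are nonnegative, so the sum is a supremum over finite sets of walks. Each finite set
    lies in some [gsaws N], with N above its longest walk, so the two bounds on [length_sum]
    suffice. *)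
Lemma expected_length (S : R) :
  (forall e : R, 0 < e -> exists N, forall n, (N <= n)%N ->
    `|strip_value k n.+1 (closed_env R) - S| <= e) ->
  L R h = (S - 1)%:E.
Proof.
move=> lim; apply/eqP; rewrite eq_le; apply/andP; split.
  apply: ge_ereal_sup => _ [A [finA Asub] <-].
  have [N AN] : exists N, A `<=` [set` gsaws N].
    have /finite_seqP[s As] := finA; exists (\max_(W <- s) len W).+1 => W AW.
    apply/mem_gsaws; split; first exact: Asub.
    have Ws : W \in s by move: AW; rewrite As.
    by rewrite ltnS; exact: (@leq_bigmax_seq _ s xpredT (fun W => len W) W Ws).
  apply: (@le_trans _ _ (length_sum R k N)%:E); last first.
    by rewrite lee_fin length_sum_le.
  rewrite -fsum_gsaws; apply: lee_fsum_nneg_subset => //.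
    by move=> W; rewrite !inE => /AN.
  by move=> W _; exact: gsaw_term_ge0.
apply/lee_addgt0Pr => e e0; have [N HN] := length_sum_ge lim e0.
rewrite -leeBlDr // -EFinB.
apply: (@le_trans _ _ (length_sum R k N)%:E); first by rewrite lee_fin.
rewrite -fsum_gsaws; apply: esum_ge; exists [set` gsaws N] => //.
by split=> // W /mem_gsaws[].
Qed.
End Esum.

(** * Certificates *)

(** This is 4r plus a tag in 0, ..., 3, so that distinct letters select distinct children of a trie
    node. *)
Definition code (l : letter) : nat :=
  match l with
  | Stay b r => r.*2.*2 + b
  | Cross r => r.*2.+1.*2
  | Enter r => r.*2.+1.*2.+1
  end.

(** Words index the tables through their letters, so that a lookup during the check costs a few list
    accesses instead of a search through the certificate. *)
Inductive trie (V : Type) := Empty | Node of option V & seq (trie V).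
Arguments Empty {V}.
Definition children V (t : trie V) := if t is Node _ s then s else [::].
Definition value V (t : trie V) := if t is Node o _ then o else None.
Fixpoint lookup V (w : word) (t : trie V) :=
  if w is l :: w' then lookup w' (nth Empty (children t) (code l)) else value t.
Fixpoint insert V (w : word) (x : V) (t : trie V) : trie V :=
  if w is l :: w' then
    Node (value t) (set_nth Empty (children t) (code l)
                      (insert w' x (nth Empty (children t) (code l))))
  else Node (Some x) (children t).

Definition add_key (p : leaf) (st : seq word * trie unit) :=
  if crossfree p.2 then st
  else if lookup p.2 st.2 is Some _ then st
  else (p.2 :: st.1, insert p.2 tt st.2).

Fixpoint gather n h (front : seq word) (t : trie unit) : seq word :=
  if n is n'.+1 then
    let st := foldr (fun w st => foldr add_key st (column_leaves h w))
      ([::], t) front in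
    front ++ gather n' h st.1 st.2
  else [::].

(* The crossing words met when T is iterated on [start_leaves], in the order used by
   the tables below.  Nothing is proved about this list: [check] verifies that it
   is closed under [column_leaves]. *)
Definition keys h :=
  let st := foldr add_key ([::], Empty) (start_leaves h) in
  gather 20 h st.1 st.2.

(** The bound on r matters because [column] looks r up in [iota 0 h]. On such a word a fresh column
    accepts every letter and is never entered, so T X takes the value [X [::]]. *)
Definition free_word h (w : word) :=
  all (fun l => if l is Stay true r then (r < h)%N else false) w.

(* An entry (w, (x, y)) claims X w = x / D, up to a small defect, and Y w = y. *)
Definition certificate := seq (word * (N * N)).

Section Check.
Variables (h : nat) (D p q E : N) (cert : certificate).

Definition table : trie (N * N) :=
  foldr (fun c t => insert c.1 c.2 t) Empty cert.

(** Free words need no row of the table: the fixed point is exactly 1 on them, and the weight 0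
    makes every error bound vanish there. *)
Definition entry (t : trie (N * N)) (w : word) : option (N * N) :=
  if free_word h w then Some (D, 0%num) else lookup w t.

Definition scale := (6 ^ N.of_nat h)%num.

(* The sums of X and Y over s, with denominators [scale * D] and [scale]; it fails on a
   leaf that the table does not cover.  All degrees are at most 3, so that the
   denominators of the leaves divide 6^h. *)
Fixpoint weigh t (s : seq leaf) : option (N * N) :=
  if s is (d, w) :: s' then
    match entry t w, weigh t s' with
    | Some (x, y), Some (a, b) =>
        let e := (scale / d)%num in
        if (e * d =? scale)%num then Some (e * x + a, e * y + b)%num else None
    | _, _ => None
    end
  else Some (0, 0)%num.

Definition check_row t (c : word * (N * N)) :=
  let: (w, (x, y)) := c in
  [&& ~~ crossfree w, (0 <? y)%num &
  if weigh t (column_leaves h w) is Some (a, b) then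
    [&& (q * b <=? p * (scale * y))%num, (a <=? scale * x + E * y)%num
      & (scale * x <=? a + E * y)%num]
  else false].

Definition check := let t := table in all (check_row t) cert.
Definition start_weight := weigh table (start_leaves h).
End Check.

Lemma code_inj : injective code.
Proof.
have code_row l : (code l)./2./2 = match l with Stay _ r | Cross r | Enter r => r end.
  by case: l => [[]|?|?] * /=; lia.
move=> l l' E; have := code_row l; rewrite E code_row.
by case: l l' E => [[] r|r|r] [[] r'|r'|r'] /= E ->; rewrite //; lia.
Qed.

Lemma map_code_inj : injective (map code).
Proof. exact/inj_map/code_inj. Qed.

Lemma lookup_empty V w : lookup w (Empty : trie V) = None.
Proof. by elim: w => //= l w IHw; rewrite nth_nil. Qed.

Lemma lookup_insert V w w' (x : V) t :
  lookup w (insert w' x t) = if map code w == map code w' then Some x else lookup w t.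
Proof.
elim: w w' t => [|l w IHw] [|l' w'] t //=.
by rewrite nth_set_nth /= eqseq_cons; case: eqP => [->|_]; rewrite ?IHw.
Qed.

Section Table.
Variable cert : certificate.
Lemma lookup_table (P : pred (word * (N * N))) w v :
  all P cert -> lookup w (table cert) = Some v -> P (w, v).
Proof.
elim: cert => [|[w' v'] c IHc] /=; first by rewrite lookup_empty.
move=> /andP[Pw' /IHc Pc]; rewrite lookup_insert; case: eqP => // /map_code_inj ->.
by case=> <-.
Qed.

Lemma table_lookup w : map code w \in [seq map code c.1 | c <- cert] ->
  lookup w (table cert) != None.
Proof.
elim: cert => //= -[w' v'] c IHc; rewrite lookup_insert inE /=.
by case: eqP.
Qed.
End Table.

Section NatBin.
Local Notation "[ n ]" := (nat_of_bin n).
Lemma nat_of_add_bin m n : [m + n]%num = ([m] + [n])%N.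
Proof. by rewrite !nat_of_binE N2Nat.inj_add. Qed.
Lemma leq_bin m n : (m <=? n)%num = ([m] <= [n])%N.
Proof. rewrite !nat_of_binE; apply/idP/idP => [/N.leb_le|] H; [|apply/N.leb_le]; lia. Qed.
Lemma ltn_bin m n : (m <? n)%num = ([m] < [n])%N.
Proof. rewrite !nat_of_binE; apply/idP/idP => [/N.ltb_lt|] H; [|apply/N.ltb_lt]; lia. Qed.
End NatBin.

Lemma free_word_crossfree h w : free_word h w -> crossfree w.
Proof. by apply: sub_all => -[[]|?|?]. Qed.

Lemma column_free h w a : free_word h w ->
  column w a (iota 0 h) false = [:: (1%num, [::])].
Proof.
elim: w a => //= -[[] r|?|?] w IHw a //= /andP[rh wf].
by rewrite mem_iota add0n rh IHw.
Qed.

(** * Convergence of the iterated transfer operator *)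

Section Domination.
Variable F : realFieldType.
Implicit Types (X Y : word -> F) (s : seq leaf).

Lemma ler_ev (P : pred word) X Y s : all (fun l => P l.2) s ->
  (forall w, P w -> `|X w| <= Y w) -> `|ev X s| <= ev Y s.
Proof.
move=> Ps XY; elim: s Ps => [|[d w] s IHs] /=; first by rewrite !ev_nil normr0.
move=> /andP[Pw /IHs {}IHs]; rewrite /ev !big_cons /= -!/(ev _ _).
apply: le_trans (ler_normD _ _) _; apply: lerD => //.
by rewrite normrM normfV normr_nat ler_wpM2r ?invr_ge0 ?XY.
Qed.

Lemma evN X s : ev (fun w => - X w) s = - ev X s.
Proof. by rewrite /ev -sumrN; apply: eq_bigr => p _; rewrite mulNr. Qed.

Lemma evB X Y s : ev (fun w => X w - Y w) s = ev X s - ev Y s.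
Proof. by rewrite evD evN. Qed.

Variables (h : nat) (good : pred word) (ys : word -> F) (theta : F).
Hypothesis theta01 : 0 <= theta < 1.
Hypothesis ys_free : forall w, free_word h w -> good w && (ys w == 0).
Hypothesis ys_row : forall w, good w -> ~~ free_word h w ->
  [/\ all (fun l => good l.2) (column_leaves h w),
      ev ys (column_leaves h w) <= theta * ys w, ~~ crossfree w & 0 < ys w].

Lemma ys_ge0 w : good w -> 0 <= ys w.
Proof.
move=> gw; case: (boolP (free_word h w)) => wf.
  by have /andP[_ /eqP ->] := ys_free wf.
by have [_ _ _ /ltW] := ys_row gw wf.
Qed.

Lemma iter_transfer_free n w : free_word h w ->
  iter n (transfer h) (closed_env F) w = 1.
Proof.
move=> wf; case: n => [|n]; first by rewrite /= /closed_env (free_word_crossfree wf).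
rewrite iterS /transfer /column_leaves column_free // ev_leaf.
by elim: n => //= n IHn; rewrite /transfer ev_leaf.
Qed.

(** In the sup norm weighted by [ys], T contracts errors by theta, and each iteration adds a defect
    of at most kappa; the geometric series sums these to kappa / (1 - theta). On free words both
    functions are 1 at all times, so the weight 0 is admissible there. *)
Lemma iter_transfer_dist (xs : word -> F) (C kappa : F) n w :
  0 <= C -> 0 <= kappa ->
  (forall w, free_word h w -> xs w = 1) ->
  (forall w, good w -> ~~ free_word h w ->
     `|ev xs (column_leaves h w) - xs w| <= kappa * ys w /\ `|xs w| <= C * ys w) ->
  good w ->
  `|iter n (transfer h) (closed_env F) w - xs w|
    <= (kappa / (1 - theta) + C * theta ^+ n) * ys w.
Proof.
move=> C0 k0 xs1 xsP; have /andP[t0 t1] := theta01.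
have t1' : 0 < 1 - theta by rewrite subr_gt0.
have d0 : 0 <= kappa / (1 - theta) by rewrite divr_ge0 // ltW.
elim: n w => [|n IHn] w gw; have y0 := ys_ge0 gw;
  (case: (boolP (free_word h w)) => wf;
   first by rewrite iter_transfer_free // xs1 // subrr normr0 mulr_ge0 //
     addr_ge0 // mulr_ge0 // exprn_ge0).
- have [_ _ /negbTE wc _] := ys_row gw wf; have [_ xC] := xsP _ gw wf.
  (* [closed_env] is 0 on crossing words, so the initial error is xs itself, and C bounds it. *)
  rewrite /= /closed_env wc sub0r normrN expr0 mulr1.
  by apply: le_trans xC _; rewrite ler_wpM2r // lerDr.
have [gs yt _ _] := ys_row gw wf; have [xk _] := xsP _ gw wf.
rewrite iterS {1}/transfer; set V := iter n _ _ in IHn *.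
have -> : ev V (column_leaves h w) - xs w =
    ev (fun u => V u - xs u) (column_leaves h w) + (ev xs (column_leaves h w) - xs w).
  by rewrite evB addrA subrK.
apply: le_trans (ler_normD _ _) _.
have := ler_ev gs IHn; rewrite evZ => H.
apply: le_trans (lerD H xk) _; rewrite exprS.
have -> : (kappa / (1 - theta) + C * (theta * theta ^+ n)) * ys w =
    (kappa / (1 - theta) + C * theta ^+ n) * (theta * ys w) + kappa * ys w.
  by field; rewrite gt_eqF.
rewrite lerD2r ler_wpM2l // addr_ge0 // mulr_ge0 // exprn_ge0 //.
Qed.
End Domination.

Lemma scale_neq0 h : (scale h : nat) != 0%N.
Proof.
rewrite /scale nat_of_binE; apply/eqP => H.
have := N.pow_nonzero 6 (N.of_nat h); case; [by []|exact/N2Nat.inj].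
Qed.

(** * Soundness of the certificate check *)

Section Sound.
Variables (F : realFieldType) (h : nat) (D p q E : N) (cert : certificate).
Hypothesis D0 : (0 < D)%N.
Let t := table cert.
Definition good w := entry h D t w != None.
Definition xval w : F := if entry h D t w is Some (x, _) then x%:R / D%:R else 0.
Definition yval w : F := if entry h D t w is Some (_, y) then y%:R else 0.

Let D0F : D%:R != 0 :> F.
Proof. by rewrite pnatr_eq0 -lt0n. Qed.

Let scale0 : (scale h)%:R != 0 :> F.
Proof. by rewrite pnatr_eq0 scale_neq0. Qed.

Lemma weigh_sound s a b : weigh h D t s = Some (a, b) ->
  [/\ all (fun l => good l.2) s, ev xval s = a%:R / ((scale h)%:R * D%:R)
    & ev yval s = b%:R / (scale h)%:R].
Proof.
elim: s a b => [|[d w] s IHs] a b /=.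
  by case=> <- <-; rewrite !ev_nil !mul0r.
rewrite /good; case Ew: (entry h D t w) => [[x y]|//] /=.
case: (weigh _ _ _ _) IHs => // -[a' b'] IHs; have [gs xE yE] := IHs _ _ erefl.
case: ifP => // /N.eqb_eq eE [<- <-].
have {}eE : (scale h / d)%num%:R * d%:R = (scale h)%:R :> F.
  by rewrite -natrM -nat_of_mul_bin eE.
have d0 : d%:R != 0 :> F by apply: contraNneq scale0 => d0; rewrite -eE d0 mulr0.
rewrite /ev !big_cons -!/(ev _ _) /= xE yE /xval /yval Ew.
rewrite !nat_of_add_bin !nat_of_mul_bin !natrD !natrM.
have -> : (scale h / d)%num%:R = (scale h)%:R / d%:R :> F by rewrite -eE mulfK.
split=> //; field.
  by rewrite D0F scale0 d0.
by rewrite scale0 d0.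
Qed.

Hypotheses (q0 : (0 < q)%N) (checked : check h D p q E cert).

Definition theta : F := p%:R / q%:R.
Definition kappa : F := E%:R / ((scale h)%:R * D%:R).

Lemma kappa_ge0 : 0 <= kappa.
Proof. by rewrite divr_ge0 // mulr_ge0. Qed.

Lemma good_free w : free_word h w -> good w && (yval w == 0).
Proof. by rewrite /good /yval /entry => ->; rewrite eqxx. Qed.

Lemma xval_free w : free_word h w -> xval w = 1.
Proof. by rewrite /xval /entry => ->; rewrite divff. Qed.

Lemma good_row w : good w -> ~~ free_word h w ->
  [/\ all (fun l => good l.2) (column_leaves h w),
      ev yval (column_leaves h w) <= theta * yval w, ~~ crossfree w & 0 < yval w]
  /\ `|ev xval (column_leaves h w) - xval w| <= kappa * yval w.
Proof.
move=> gw /negbTE wf; move: gw; rewrite /good /xval /yval /entry wf.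
case tw: (lookup w t) => [[x y]|//] _.
have := @lookup_table cert _ w (x, y) checked tw.
rewrite /check_row => /and3P[wc]; rewrite ltn_bin /= => y0.
case Ew: (weigh _ _ _ _) => [[a b]|//].
have [gs xE yE] := weigh_sound Ew.
rewrite !leq_bin !(nat_of_add_bin, nat_of_mul_bin).
rewrite -!(ler_nat F) !natrD !natrM => /and3P[H1 H2 H3].
have s0 : 0 < (scale h)%:R :> F by rewrite lt_def scale0 ler0n.
have q0' : 0 < q%:R :> F by rewrite ltr0n.
have D0' : 0 < D%:R :> F by rewrite ltr0n.
split.
  split; [exact: gs| |exact: wc|by rewrite ltr0n].
  rewrite -/yval yE /theta ler_pdivrMr //.
  have -> : p%:R / q%:R * y%:R * (scale h)%:R = p%:R * ((scale h)%:R * y%:R) / q%:R :> F.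
    by field; rewrite (gt_eqF q0').
  by rewrite ler_pdivlMr // mulrC.
rewrite -/xval xE /kappa.
have -> : a%:R / ((scale h)%:R * D%:R) - x%:R / D%:R =
    (a%:R - (scale h)%:R * x%:R) / ((scale h)%:R * D%:R) :> F.
  by field; rewrite (gt_eqF s0) (gt_eqF D0').
rewrite normrM normfV [`|_ * D%:R|]gtr0_norm ?mulr_gt0 // mulrAC.
rewrite ler_wpM2r ?invr_ge0 ?mulr_ge0 // ler_norml; apply/andP; split; lra.
Qed.

(** The table is finite and its positive integer weights are at least 1, so any bound of xs on the
    table works. *)
Lemma bounded_on_keys (xs : word -> F) : exists2 C : F, 0 <= C &
  forall w, good w -> ~~ free_word h w -> `|xs w| <= C * yval w.
Proof.
have [C C0 HC] : exists2 C : F, 0 <= C & all (fun c => `|xs c.1| <= C) cert.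
  elim: (cert) => [|c s [C C0 HC]]; first by exists 0.
  exists (`|xs c.1| + C) => /=; first by rewrite addr_ge0.
  rewrite lerDl C0 /=; apply: sub_all HC => c' /le_trans; apply.
  by rewrite lerDr.
exists C => // w gw wf; have [[_ _ _ y0] _] := good_row gw wf; move: gw y0.
rewrite /good /yval /entry (negbTE wf); case tw: (lookup w t) => [[x y]|//] _.
rewrite ltr0n => y0; apply: le_trans (lookup_table HC tw) _.
by rewrite ler_peMr // ler1n.
Qed.

Variables (a b : N).
Hypothesis startE : start_weight h D cert = Some (a, b).
Hypothesis pq : (p < q)%N.

Lemma theta01 : 0 <= theta < 1.
Proof. by rewrite divr_ge0 //= ltr_pdivrMr ?ltr0n // mul1r ltr_nat. Qed.

(** An approximate fixed point of T on the covered words, with its defect measured relative to Y;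
    [kap] = 0 means an exact one. The value 1 on free words is the limit of the iterates there. *)
Definition solution (kap : F) (xs : word -> F) :=
  (forall w, free_word h w -> xs w = 1) /\
  (forall w, good w -> ~~ free_word h w ->
    `|ev xs (column_leaves h w) - xs w| <= kap * yval w).

Lemma iter_start_dist (xs : word -> F) (C kap : F) n :
  0 <= C -> 0 <= kap -> solution kap xs ->
  (forall w, good w -> ~~ free_word h w -> `|xs w| <= C * yval w) ->
  `|ev (iter n (transfer h) (closed_env F)) (start_leaves h) - ev xs (start_leaves h)|
    <= (kap / (1 - theta) + C * theta ^+ n) * (b%:R / (scale h)%:R).
Proof.
move=> C0 k0 [xs1 xsE] xsC; have [gs _ yE] := weigh_sound startE.
rewrite -evB -yE -evZ; apply: ler_ev gs _ => w.
apply: iter_transfer_dist => //.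
- exact: theta01.
- exact: good_free.
- by move=> w' gw wf; have [] := good_row gw wf.
- by move=> w' gw wf; split; [exact: xsE|exact: xsC].
Qed.

Lemma xval_solution : solution kappa xval.
Proof.
by split=> [|w gw wf]; [exact: xval_free|have [] := good_row gw wf].
Qed.

Lemma ev_start : ev xval (start_leaves h) = a%:R / ((scale h)%:R * D%:R).
Proof. by have [] := weigh_sound startE. Qed.
End Sound.

(** * Existence of an exact fixed point over any real field *)

Section Exists.
Variables (F : realFieldType) (h : nat) (D p q E : N) (cert : certificate).
Hypotheses (D0 : (0 < D)%N) (q0 : (0 < q)%N) (pq : (p < q)%N).
Hypothesis checked : check h D p q E cert.

Local Notation good := (good h D cert).
Local Notation yval := (@yval F h D cert).
Local Notation theta := (theta F p q).

Lemma eq_ev_all (P : pred word) (X Y : word -> F) s : all (fun l => P l.2) s ->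
  {in P, X =1 Y} -> ev X s = ev Y s.
Proof.
move=> Ps XY; elim: s Ps => [|[d w] s IHs] /=; first by rewrite !ev_nil.
by move=> /andP[Pw /IHs {}IHs]; rewrite /ev !big_cons -!/(ev _ _) IHs /= XY.
Qed.

Let codes := [seq map code c.1 | c <- cert].
Let n := size codes.
Let key (i : 'I_n) : word := nth [::] (map fst cert) i.
Let idx (w : word) := index (map code w) codes.

Lemma key_code i : map code (key i) = nth [::] codes i.
Proof.
have ic : (i < size cert)%N by rewrite -(size_map (fun c => map code c.1)).
by rewrite /key /codes !(nth_map ([::], (0, 0)%num)).
Qed.

Lemma good_code w : good w -> ~~ free_word h w -> map code w \in codes.
Proof.
move=> + wf; rewrite /good /entry (negbTE wf); case tw: (lookup _ _) => [v|//] _.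
apply: (@lookup_table cert (fun c => map code c.1 \in codes) w v _ tw).
by rewrite -(all_map (fun c => map code c.1) (mem codes)); apply/allP.
Qed.

Lemma key_good i : good (key i) /\ ~~ free_word h (key i).
Proof.
have tk : lookup (key i) (table cert) != None.
  by apply: table_lookup; rewrite key_code mem_nth.
have kf : ~~ free_word h (key i).
  case tw: lookup tk => [[x y]|//] _.
  have := @lookup_table cert _ (key i) (x, y) checked tw.
  by rewrite /check_row => /and3P[kc _ _]; apply: contra kc; exact: free_word_crossfree.
by split; rewrite // /good /entry (negbTE kf).
Qed.

Lemma key_idx w (i : 'I_n) : idx w = i -> key i = w.
Proof.
move=> wi; apply: map_code_inj; rewrite key_code -wi nth_index //.
by rewrite -index_mem -/(idx w) wi.
Qed.

(** Coordinates for the values at table words. Free words are excluded because their values are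
    prescribed and go into the inhomogeneous term. *)
Let delta (j : 'I_n) (w : word) : F := (~~ free_word h w && (idx w == j))%:R.

Lemma sum_delta w (G : 'I_n -> F) (H : word -> F) :
  (forall j : 'I_n, idx w = j -> G j = H w) -> good w ->
  \sum_j G j * delta j w = (~~ free_word h w)%:R * H w.
Proof.
move=> GH gw; rewrite /delta; case: (boolP (free_word h w)) => wf /=.
  by rewrite big1 ?mul0r // => j _; rewrite mulr0.
have wn : (idx w < n)%N by rewrite index_mem good_code.
rewrite (bigD1 (Ordinal wn)) //= eqxx mulr1 big1 ?addr0 ?mul1r => [|j jw].
  exact: GH.
by rewrite eq_sym [_ == _](negbTE jw) mulr0.
Qed.

(** Acts on row vectors from the right: column i holds the coefficients of T at [key i], so the
    fixed point equation reads z = b + z *m Mx. *)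
Let Mx : 'M[F]_n := \matrix_(j, i) ev (delta j) (column_leaves h (key i)).

Lemma Mx_ge0 i j : 0 <= Mx j i.
Proof. by rewrite mxE sumr_ge0 // => l _; rewrite divr_ge0. Qed.

(* At an index where |z| / Y is maximal, T Y <= theta Y with theta < 1 forces z = 0. *)
Lemma Mx_kernel (z : 'rV[F]_n) : z *m (1%:M - Mx) = 0 -> z = 0.
Proof.
rewrite mulmxBr mulmx1 => /subr0_eq zE.
case: (posnP n) => [n0|n0]; first by apply/rowP => i; have := ltn_ord i; rewrite {2}n0.
have ykey i : 0 < yval (key i).
  have [gk kf] := key_good i.
  by have [[]] := good_row F D0 q0 checked gk kf.
pose r i := `|z 0 i| / yval (key i).
case: (arg_maxP r (i0 := Ordinal n0) (P := predT) erefl) => i _ rmax.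
have r0 j : 0 <= r j by rewrite divr_ge0 // ltW.
have zr j : `|z 0 j| = r j * yval (key j) by rewrite divfK // gt_eqF.
have zi : `|z 0 i| <= r i * (theta * yval (key i)).
  have [gk kf] := key_good i.
  have [[gs ys _ _] _] := good_row F D0 q0 checked gk kf.
  apply: (@le_trans _ _ (r i * \sum_j yval (key j) * Mx j i)).
    rewrite {1}zE mxE mulr_sumr; apply: le_trans (ler_norm_sum _ _ _) _.
    apply: ler_sum => j _; rewrite normrM (ger0_norm (Mx_ge0 _ _)) mulrA.
    apply: ler_wpM2r; first exact: Mx_ge0.
    by rewrite zr; apply: ler_wpM2r; [exact/ltW/ykey|exact: rmax].
  rewrite ler_wpM2l //; apply: le_trans ys.
  rewrite (eq_bigr (fun j => ev (fun w => yval (key j) * delta j w) (column_leaves h (key i)))).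
    rewrite -ev_sum (eq_ev_all gs (Y := yval)) // => w gw.
    rewrite (sum_delta (H := yval)) // => [|j /key_idx -> //].
    case: (boolP (free_word h w)) => wf; last by rewrite mul1r.
    by have /andP[_ /eqP ->] := good_free F D cert wf; rewrite mulr0.
  by move=> j _; rewrite mxE evZ.
have /andP[_ t1] := theta01 F q0 pq.
have ri0 : r i = 0.
  apply/eqP; rewrite eq_le r0 andbT.
  move: zi; rewrite {1}zr mulrA ler_pM2r ?ykey // => ri.
  have : r i * (1 - theta) <= 0 by rewrite mulrBr mulr1 subr_le0.
  by rewrite pmulr_lle0 // subr_gt0.
apply/rowP => j; rewrite mxE; apply/eqP; rewrite -normr_eq0 zr.
have := rmax j isT; rewrite ri0 => rj.
have -> : r j = 0 by apply/eqP; rewrite eq_le r0 andbT.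
by rewrite mul0r.
Qed.

(** The trivial kernel makes 1 - Mx invertible, and the leaves with free words, where X is 1,
    provide the term b. Used over the rationals, this gives the rationality of the expected
    length. *)
Lemma exists_solution : exists xs : word -> F, solution h D cert 0 xs.
Proof.
have Au : 1%:M - Mx \in unitmx.
  rewrite -row_free_unit -kermx_eq0; apply/eqP/row_matrixP => i.
  by rewrite row0; apply: Mx_kernel; rewrite -row_mul mulmx_ker row0.
pose b : 'rV[F]_n := \row_i ev (fun w => (free_word h w)%:R) (column_leaves h (key i)).
pose z := b *m invmx (1%:M - Mx).
have zE : z = b + z *m Mx.
  by apply/eqP; rewrite -subr_eq -{1}[z]mulmx1 -mulmxBr mulmxKV.
pose xs w := (free_word h w)%:R + \sum_j z 0 j * delta j w.
exists xs; split=> [w wf|w gw wf].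
  by rewrite /xs wf big1 ?addr0 // => j _; rewrite /delta wf mulr0.
have wn : (idx w < n)%N by rewrite index_mem good_code.
have kw : key (Ordinal wn) = w by exact: key_idx.
have -> : xs w = z 0 (Ordinal wn).
  rewrite /xs (negbTE wf) add0r (sum_delta (H := fun=> z 0 (Ordinal wn))) // => [|j wj].
    by rewrite wf mul1r.
  by congr (z 0 _); apply/val_inj; rewrite /= wj.
rewrite {1}zE 2!mxE mxE kw /xs evD ev_sum.
rewrite (eq_bigr (fun j => z 0 j * Mx j (Ordinal wn))) => [|j _].
  by rewrite subrr normr0 mul0r.
by rewrite evZ [Mx _ _]mxE kw.
Qed.
End Exists.

Section Geometric.
Local Open Scope classical_set_scope.
Import numFieldNormedType.Exports.

Lemma geometric_small (R : realType) (theta B e : R) : 0 <= theta < 1 -> 0 < e ->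
  exists N, forall n, (N <= n)%N -> B * theta ^+ n <= e.
Proof.
move=> /andP[t0 t1] e0.
have : geometric B theta @ \oo --> (0 : R) by apply: cvg_geometric; rewrite ger0_norm.
move/cvgrPdist_le => /(_ e e0)[N _ HN]; exists N => n /HN /=.
by rewrite sub0r normrN; apply: le_trans; exact: ler_norm.
Qed.

End Geometric.

Lemma ratr_ev (R : realFieldType) (X : word -> rat) s :
  ratr (ev X s) = ev (fun w => ratr (X w) : R) s.
Proof.
rewrite /ev rmorph_sum; apply: eq_bigr => l _.
by rewrite fmorph_div /= ratr_nat.
Qed.

(** * From a verified certificate to the expected length *)

Section Certified.
Variables (R : realType) (k : nat).
Notation h := k.+1.
Variables (D p q E a b : N) (cert : certificate).
Hypotheses (D0 : (0 < D)%N) (q0 : (0 < q)%N) (pq : (p < q)%N).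
Hypothesis checked : check h D p q E cert.
Hypothesis startE : start_weight h D cert = Some (a, b).

Local Notation start_value xs := (ev xs (start_leaves h)).

Lemma strip_value_dist (kap : R) (xs : word -> R) : 0 <= kap ->
  solution h D cert kap xs ->
  exists C : R, forall n,
  `|strip_value k n.+1 (closed_env R) - start_value xs|
    <= kap / (1 - theta R p q) * (b%:R / (scale h)%:R) + C * theta R p q ^+ n.
Proof.
move=> k0 sol; have [C C0 xsC] := bounded_on_keys D0 q0 checked xs.
exists (C * (b%:R / (scale h)%:R)) => n; rewrite strip_value_iter.
have := iter_start_dist D0 q0 checked startE pq n C0 k0 sol xsC.
by rewrite mulrDl [C * _ * _ in X in _ -> X]mulrAC.
Qed.

Lemma strip_value_lim (xs : word -> R) : solution h D cert 0 xs ->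
  forall e : R, 0 < e -> exists N, forall n, (N <= n)%N ->
    `|strip_value k n.+1 (closed_env R) - start_value xs| <= e.
Proof.
move=> sol e e0; have [C HC] := strip_value_dist (lexx 0) sol.
have [N HN] := geometric_small C (theta01 R q0 pq) e0.
exists N => n /HN; apply: le_trans; apply: le_trans (HC n) _.
by rewrite !mul0r add0r.
Qed.

(** The exact fixed point, solved over [rat] and carried to R by [ratr], is the limit of the strip
    values. Comparing one strip value of large index with both the exact fixed point and the table
    bounds the distance between these two. *)
Lemma rational_length : exists r : rat, L R h = (ratr r)%:E /\
  `|r + 1 - a%:R / ((scale h)%:R * D%:R)|
    <= kappa rat h D E / (1 - theta rat p q) * (b%:R / (scale h)%:R).
Proof.
have [X [X1 XE]] := exists_solution rat D0 q0 pq checked.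
have sol : solution h D cert 0 (fun w => ratr (X w) : R).
  split=> [w /X1 ->|w gw wf]; first exact: rmorph1.
  have := XE w gw wf; rewrite !mul0r !normr_le0 !subr_eq0 => /eqP <-.
  by rewrite ratr_ev.
have lim := strip_value_lim sol.
exists (start_value X - 1); split.
  by rewrite (expected_length lim) rmorphB /= ratr_ev rmorph1.
rewrite subrK -(ler_rat R).
have xsol := xval_solution R D0 q0 checked.
have [C HC] := strip_value_dist (kappa_ge0 R h D E) xsol.
rewrite (ev_start R D0 startE) in HC.
have -> : ratr (kappa rat h D E / (1 - theta rat p q) * (b%:R / (scale h)%:R))
    = kappa R h D E / (1 - theta R p q) * (b%:R / (scale h)%:R) :> R.
  rewrite /kappa /theta !(rmorphM, fmorphV, rmorphB) /=.
  by rewrite ?(rmorphM, fmorphV) /= !(ratr_nat, rmorph1).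
have -> : ratr `|start_value X - a%:R / ((scale h)%:R * D%:R)|
    = `|start_value (fun w => ratr (X w)) - a%:R / ((scale h)%:R * D%:R)| :> R.
  by rewrite ratr_norm rmorphB /= ratr_ev fmorph_div rmorphM /= !ratr_nat.
apply/ler_addgt0Pr => e e0; have e20 : 0 < e / 2 by rewrite divr_gt0.
have [N1 H1] := lim _ e20.
have [N2 H2] := geometric_small C (theta01 R q0 pq) e20.
have h1 := H1 _ (leq_maxl N1 N2); have h2 := H2 _ (leq_maxr N1 N2).
have h3 := HC (maxn N1 N2).
set V := strip_value _ _ _ in h1 h3; rewrite distrC in h1.
have := ler_distD V (start_value (fun w => ratr (X w))) (a%:R / ((scale h)%:R * D%:R)).
set A := _ / _ * _ in h3 *; lra.
Qed.

Lemma exact_length (E0 : E = 0%num) :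
  L R h = (a%:R / ((scale h)%:R * D%:R) - 1)%:E.
Proof.
have [r [-> +]] := rational_length.
rewrite /kappa E0 !mul0r normr_le0 subr_eq0 => /eqP/(canRL (addrK _)) ->.
by rewrite rmorphB /= rmorph1 fmorph_div rmorphM /= !ratr_nat.
Qed.
End Certified.

Definition exact_check h D p q cert num den :=
  [&& (0 <? D)%num, (0 <? q)%num, (p <? q)%num, (0 <? den)%num,
      check h D p q 0%num cert &
      if start_weight h D cert is Some (a, _) then
        (a * den =? (num + den) * (scale h * D))%num
      else false].

Lemma exact_checkP (R : realType) k D p q cert num den :
  exact_check k.+1 D p q cert num den -> L R k.+1 = (num%:R / den%:R)%:E.
Proof.
rewrite /exact_check !ltn_bin; case/and5P => D0 q0 pq den0 /andP[checked].
case startE: (start_weight _ _ _) => [[a b]|//] /N.eqb_eq aE.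
rewrite (exact_length R D0 q0 pq checked startE erefl); congr (_%:E).
have {}aE : a%:R * den%:R = (num%:R + den%:R) * ((scale k.+1)%:R * D%:R) :> R.
  by rewrite -!natrM -natrD -natrM -!nat_of_mul_bin aE !nat_of_mul_bin nat_of_add_bin.
have s0 : (scale k.+1)%:R != 0 :> R by rewrite pnatr_eq0 scale_neq0.
have D0' : D%:R != 0 :> R by rewrite pnatr_eq0 -lt0n.
have den0' : den%:R != 0 :> R by rewrite pnatr_eq0 -lt0n.
apply: (mulIf den0'); rewrite divfK // mulrBl mulrAC aE mulfK ?mulf_neq0 //.
by rewrite mul1r addrK.
Qed.

Lemma nat_of_exp_bin m n : (m ^ N.of_nat n)%num = (m ^ n)%N :> nat.
Proof.
elim: n => // n IHn; rewrite expnS -IHn -nat_of_mul_bin -N.pow_succ_r'.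
by rewrite Nat2N.inj_succ.
Qed.

(** With s = 6^h, u = s D (q - p) s, A = a (q - p) s and B = E q b, the value r + 1 lies within B /
    u of A / u; the factor q / (q - p) is 1 / (1 - p / q). The two tests are m <= r w + 1/2 < m + 1,
    where w = 10^n, at the ends of this interval and multiplied by 2u. *)
Definition round_check h D p q E cert n m :=
  let w := (10 ^ N.of_nat n)%num in
  [&& (0 <? D)%num, (0 <? q)%num, (p <? q)%num, check h D p q E cert &
      if start_weight h D cert is Some (a, b) then
        let s := scale h in
        let center := (2 * w * (a * (q - p) * s))%num in
        let radius := (2 * w * (E * q * b))%num in
        let unit := (s * D * (q - p) * s)%num in
        ((2 * m + 2 * w) * unit + radius <=? center + unit)%num
        && (center + radius <? (2 * m + 2 * w + 1) * unit)%num
      else false].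

Lemma round_checkP (R : realType) k D p q E cert n m :
  round_check k.+1 D p q E cert n m ->
  exists r : rat, L R k.+1 = (ratr r)%:E /\ round_dec n r = m%:R / 10 ^+ n.
Proof.
have wE : (10 ^ N.of_nat n)%num%:R = 10 ^+ n :> rat.
  by rewrite nat_of_exp_bin natrX.
rewrite /round_check; set w := (10 ^ _)%num in wE *; rewrite !ltn_bin; case/and5P => D0 q0 pq checked.
case startE: (start_weight _ _ _) => [[a b]|//].
have [r [LE rE]] := rational_length R D0 q0 pq checked startE.
lazy beta zeta iota; rewrite leq_bin ltn_bin !(nat_of_add_bin, nat_of_mul_bin) => /andP[].
rewrite -(ler_nat rat) -(ltr_nat rat) !(natrD, natrM).
have -> : (q - p)%num%:R = q%:R - p%:R :> rat.
  by rewrite nat_of_binE N2Nat.inj_sub -!nat_of_binE natrB // ltnW.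
rewrite [nat_of_bin 2%num]/= [nat_of_bin 1%num]/=.
set s := (scale _)%:R in rE *; rewrite /kappa /theta -/s in rE.
have s0 : 0 < s by rewrite ltr0n lt0n scale_neq0.
move: D0 q0 pq; rewrite -!(ltr_nat rat) => D0 q0 pq.
set u := s * D%:R * (q%:R - p%:R) * s.
have u0 : 0 < u by rewrite !mulr_gt0 // subr_gt0.
have w0 : 0 < w%:R :> rat by rewrite wE exprn_gt0.
move: rE; rewrite ler_norml => /andP[lo hi] H1 H2.
exists r; split=> //; rewrite /round_dec -wE; congr (_ / _).
have cE : a%:R / (s * D%:R) = a%:R * (q%:R - p%:R) * s / u.
  rewrite /u; field; rewrite !gt_eqF ?subr_gt0 //.
have dE : E%:R / (s * D%:R) / (1 - p%:R / q%:R) * (b%:R / s) = E%:R * q%:R * b%:R / u.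
  rewrite /u; field; rewrite !gt_eqF ?subr_gt0 //.
rewrite cE dE in lo hi.
set A := a%:R * _ * s in cE lo hi H1 H2; set B := E%:R * q%:R * b%:R in dE lo hi H1 H2.
have lo' : (A - B) / u <= r + 1 by rewrite mulrBl; lra.
have hi' : r + 1 <= (A + B) / u by rewrite mulrDl; lra.
rewrite ler_pdivrMr // in lo'; rewrite ler_pdivlMr // in hi'.
suff -> : Num.floor (r * w%:R + 1 / 2) = Posz m by [].
apply/floor_def; rewrite -[Posz m + 1]/(Posz (m + 1)%N) -!pmulrn natrD.
have wlo := ler_wpM2l (ltW w0) lo'; have whi := ler_wpM2l (ltW w0) hi'.
by apply/andP; split; rewrite -(ler_pM2r u0, ltr_pM2r u0); nra.
Qed.

(** * The certificates for heights 3, 4 and 5 *)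

(** 18 times the denominator of L_3; it clears the denominators of the whole fixed point. The first
    entry of [values3] divided by it is L_3 + 1. *)
Definition denominator3 : N := 455711166%num.
Definition values3 : seq N := [::
    9211177584; 6393687669; 186354729; 6188452392; 119052672; 89289504;
    29763168; 39684224; 135992844; 26042772; 109950072; 2193528448; 9211177584;
    6393687669; 186354729; 6188452392; 135992844; 26042772; 109950072;
    2193528448; 119052672; 89289504; 29763168; 39684224; 7471714050; 173824650;
    7471714050; 5119431219; 157383954; 173824650; 157383954]%num.
Definition weights3 : seq N := [::
    1375; 875; 22; 864; 20; 14; 11; 18; 16; 11; 10; 369; 1375; 875; 22; 864;
    16; 11; 10; 369; 20; 14; 11; 18; 1070; 26; 1070; 673; 17; 26; 17]%num.
(** 624 times the denominator of L_4, in the same role. *)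
Definition denominator4 : N := 988585704018748166074950471937434571098106552355990137588526160%num.
Definition values4 : seq N := [::
    23701413595408165639576548472628829412958037153328732016942600256;
    17515476163313651757359530207674705458921293466378430386862053160;
    375974054305904099791025672674381028578181641884025124582222424;
    16120167776642872758202824323865331330215827055252819032717689112;
    199129133178789298948360069048604052740507188010840370515266560;
    135114103928961968257624086427327579250036769499801822202628096;
    64015029249827330690735982621276473490470418511038548312638464;
    99983409667677681600393498058087096082670930155211385446650880;
    235744897042154821463241921859911362867022867485046498044613920;
    54902786375633945571599271135268083389300724179551645712854240;
    180842110666520875891642650724643279477722143305494852331759680;
    3734320179517932773567288235788742975939810100822390469887255680;
    15178270224366942640735688247427829314564988017543074507818960976;
    152988658528370077307985377273672024612101858993979238711720960;
    98147399464711783068625693867870347397367461911247731490851840;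
    82620587525405608885047631696375658421860117007962312063010816;
    15526811939306174183578062171494688975507344903285419427841024;
    23403429495155897767987894633815152096719425564545476841303040;
    54841259063658294239359683405801677214734397082731507220869120;
    16594094431565774912363339087383671061708932334236697542938880;
    38247164632092519326996344318418006153025464748494809677930240;
    108695015475295957304367999489040187099198724316220965817229312;
    123599885367339249843122330417264266176031766966942017524957312;
    30926523391104203789933548115834097136778463375384877990823808;
    155556411870457289999162554229138516513916674780681349732751104;
    30765331401216800203774191828797751192171464058743683401341184;
    124791080469240489795388362400340765321745210721937666331409920;
    2654951316423379557815974915313931186003597149715936269106481920; 0;
    112791813370320577595777276506981497235698429821434199405863680;
    42764598500136712403385277722157019278218244959247150326887424;
    65697534171967035279697317410564714658289680217400498500183296; 0;
    271971091517730942452876758682955603509472113509708037483754656;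
    39214034635173512493832490355977607449086326406282671848061632;
    16851682531775356860920837794634272969951734356106376086510400;
    22362352103398155632911652561343334479134592050176295761551232;
    425819408614324792382586118036678119611435313884823762573197760;
    232757056882557429959044268326977996060385787103425365635693024; 0;
    232757056882557429959044268326977996060385787103425365635693024;
    4878028509224712645422889076405576245512707794627329903379114336;
    3661822073152990477039644432206940760766480809032688694601020928;
    107517454735963767555229914487071393504864890431730741857629840;
    23701413595408165639576548472628829412958037153328732016942600256;
    17515476163313651757359530207674705458921293466378430386862053160;
    375974054305904099791025672674381028578181641884025124582222424;
    16120167776642872758202824323865331330215827055252819032717689112;
    235744897042154821463241921859911362867022867485046498044613920;
    54902786375633945571599271135268083389300724179551645712854240;
    180842110666520875891642650724643279477722143305494852331759680;
    3734320179517932773567288235788742975939810100822390469887255680;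
    199129133178789298948360069048604052740507188010840370515266560;
    135114103928961968257624086427327579250036769499801822202628096;
    64015029249827330690735982621276473490470418511038548312638464;
    99983409667677681600393498058087096082670930155211385446650880;
    15178270224366942640735688247427829314564988017543074507818960976;
    271971091517730942452876758682955603509472113509708037483754656;
    39214034635173512493832490355977607449086326406282671848061632;
    16851682531775356860920837794634272969951734356106376086510400;
    22362352103398155632911652561343334479134592050176295761551232;
    425819408614324792382586118036678119611435313884823762573197760;
    232757056882557429959044268326977996060385787103425365635693024; 0;
    232757056882557429959044268326977996060385787103425365635693024;
    4878028509224712645422889076405576245512707794627329903379114336;
    3661822073152990477039644432206940760766480809032688694601020928;
    107517454735963767555229914487071393504864890431730741857629840;
    155556411870457289999162554229138516513916674780681349732751104;
    112791813370320577595777276506981497235698429821434199405863680;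
    42764598500136712403385277722157019278218244959247150326887424;
    65697534171967035279697317410564714658289680217400498500183296; 0;
    30765331401216800203774191828797751192171464058743683401341184;
    124791080469240489795388362400340765321745210721937666331409920;
    2654951316423379557815974915313931186003597149715936269106481920; 0;
    152988658528370077307985377273672024612101858993979238711720960;
    98147399464711783068625693867870347397367461911247731490851840;
    82620587525405608885047631696375658421860117007962312063010816;
    15526811939306174183578062171494688975507344903285419427841024;
    23403429495155897767987894633815152096719425564545476841303040;
    54841259063658294239359683405801677214734397082731507220869120;
    16594094431565774912363339087383671061708932334236697542938880;
    38247164632092519326996344318418006153025464748494809677930240;
    108695015475295957304367999489040187099198724316220965817229312;
    123599885367339249843122330417264266176031766966942017524957312;
    30926523391104203789933548115834097136778463375384877990823808;
    18239605946543480026119125392146617485776281240210344475134889658;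
    224101406423755816242875900976835282099849859554433839994340672;
    37728732174294951603898861734546326858641129840215395749630656;
    186372674249460864638977039242288955241208729714218444244710016;
    3990231986068146163268390969564038380135764407622828557116732480;
    213677052467374691479641572864031660264275397396546877290796032;
    150538746187933509784100219914538147518686534146697021298457472;
    63138306279441181695541352949493512745588863249849855992338560;
    145781775140042525251841882510668303082787370355859502325443584;
    20559426117755778441654756752631158440730499251772913742618338224;
    14803960013454938573398229529568051633193876229634258993533395472;
    344145542156845481214093180957022954407842450469390655064784804;
    12798454930779168931563997687877565568527975876897571105063832657;
    201894121562870661723679688746068014034411965374541848937199968;
    39727128098329437185610029769494341398343977031916483271635344;
    162166993464541224538069658976573672636067988342625365665564624;
    3383125730143607608608015996577003504086842245224285270127999584;
    170413123031589292664774322863627180678547113669684412585034752;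
    124204514820709852930675137981020012210099644941691437379962624;
    46208608210879439734099184882607168468447468727992975205072128;
    70028507367059580206103210110195432470415699509177520478630912;
    301533272991081649676202553111813334245318655507063395428356400;
    248037727065286947581473437682106068446596996019854420861716938;
    318639374481343031083270112909224320940158002976346277416920003;
    40204436398810886623493673748241777899375820734275119390447520; 0;
    14803960013454938573398229529568051633193876229634258993533395472;
    248037727065286947581473437682106068446596996019854420861716938;
    18239605946543480026119125392146617485776281240210344475134889658;
    12798454930779168931563997687877565568527975876897571105063832657;
    318639374481343031083270112909224320940158002976346277416920003;
    344145542156845481214093180957022954407842450469390655064784804;
    213677052467374691479641572864031660264275397396546877290796032;
    170413123031589292664774322863627180678547113669684412585034752;
    145781775140042525251841882510668303082787370355859502325443584;
    70028507367059580206103210110195432470415699509177520478630912; 0;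
    150538746187933509784100219914538147518686534146697021298457472;
    63138306279441181695541352949493512745588863249849855992338560;
    124204514820709852930675137981020012210099644941691437379962624;
    46208608210879439734099184882607168468447468727992975205072128;
    224101406423755816242875900976835282099849859554433839994340672;
    201894121562870661723679688746068014034411965374541848937199968;
    20559426117755778441654756752631158440730499251772913742618338224;
    301533272991081649676202553111813334245318655507063395428356400;
    37728732174294951603898861734546326858641129840215395749630656;
    186372674249460864638977039242288955241208729714218444244710016;
    3990231986068146163268390969564038380135764407622828557116732480;
    39727128098329437185610029769494341398343977031916483271635344;
    162166993464541224538069658976573672636067988342625365665564624;
    3383125730143607608608015996577003504086842245224285270127999584;
    40204436398810886623493673748241777899375820734275119390447520;
    13926801546156302800249339811497151332939331562943424696578944;
    16838529855060497403524852017300599859232132495800258704762240;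
    28821876498229647733220672137280842796255287717720190461360896;
    98865011824164274795527936695484345902759098258490774709284736;
    25926068645076214999860425704856419418986112463446891622125184;
    36875657673737387546476645273283871862034392499680308038822400;
    99214681956971383797410970783759329483569049342199009605949696;
    82620587525405608885047631696375658421860117007962312063010816;
    16594094431565774912363339087383671061708932334236697542938880;
    24926045237205581712396130592224262401931509847170979663493120;
    53773976571398693510574406489912695128532809651780229105771264;
    15526811939306174183578062171494688975507344903285419427841024;
    38247164632092519326996344318418006153025464748494809677930240;
    108392707284234152683247686622331909479890105585103032830203904;
    122208145110536522815603397384931562053183579550801130648707968;
    30926523391104203789933548115834097136778463375384877990823808;
    13926801546156302800249339811497151332939331562943424696578944;
    98865011824164274795527936695484345902759098258490774709284736;
    2186533361707740083180118670390086235584011512299833332633276416;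
    16838529855060497403524852017300599859232132495800258704762240;
    25926068645076214999860425704856419418986112463446891622125184;
    468417954715639474635856244923844950419585637416102936473205504;
    21390672267569306712373595739658548467875140721726929381719943015;
    18787536074819437234926311204167009543397010884725311375553196826;
    328153631819863070988278843400661192052644601929459565259667488;
    16851682531775356860920837794634272969951734356106376086510400;
    16851682531775356860920837794634272969951734356106376086510400; 0; 0;
    255119408985955585591955920888321330539520379153601661397244256;
    22362352103398155632911652561343334479134592050176295761551232;
    232757056882557429959044268326977996060385787103425365635693024;
    5007485180864999184742087783929741933269039341821196951256473638;
    4099602082886253875743528218794205974800030619576373465593784868;
    102963128784912241002587359318145694788147077102724498112624608;
    13926801546156302800249339811497151332939331562943424696578944;
    98865011824164274795527936695484345902759098258490774709284736;
    2186533361707740083180118670390086235584011512299833332633276416;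
    16838529855060497403524852017300599859232132495800258704762240;
    25926068645076214999860425704856419418986112463446891622125184;
    468417954715639474635856244923844950419585637416102936473205504;
    21390672267569306712373595739658548467875140721726929381719943015;
    18787536074819437234926311204167009543397010884725311375553196826;
    328153631819863070988278843400661192052644601929459565259667488;
    16851682531775356860920837794634272969951734356106376086510400;
    16851682531775356860920837794634272969951734356106376086510400; 0; 0;
    255119408985955585591955920888321330539520379153601661397244256;
    22362352103398155632911652561343334479134592050176295761551232;
    232757056882557429959044268326977996060385787103425365635693024;
    5007485180864999184742087783929741933269039341821196951256473638;
    4099602082886253875743528218794205974800030619576373465593784868;
    102963128784912241002587359318145694788147077102724498112624608;
    13926801546156302800249339811497151332939331562943424696578944;
    16838529855060497403524852017300599859232132495800258704762240;
    28821876498229647733220672137280842796255287717720190461360896;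
    98865011824164274795527936695484345902759098258490774709284736;
    25926068645076214999860425704856419418986112463446891622125184;
    36875657673737387546476645273283871862034392499680308038822400;
    99214681956971383797410970783759329483569049342199009605949696;
    82620587525405608885047631696375658421860117007962312063010816;
    16594094431565774912363339087383671061708932334236697542938880;
    24926045237205581712396130592224262401931509847170979663493120;
    53773976571398693510574406489912695128532809651780229105771264;
    15526811939306174183578062171494688975507344903285419427841024;
    38247164632092519326996344318418006153025464748494809677930240;
    108392707284234152683247686622331909479890105585103032830203904;
    122208145110536522815603397384931562053183579550801130648707968;
    30926523391104203789933548115834097136778463375384877990823808]%num.
Definition weights4 : seq N := [::
    16169; 11231; 152; 10080; 114; 68; 69; 141; 99; 65; 57; 2826; 9636; 122;
    78; 63; 37; 63; 67; 33; 56; 176; 183; 62; 87; 49; 61; 2106; 28; 54; 56;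
    116; 28; 87; 63; 48; 38; 397; 47; 23; 47; 3497; 2550; 71; 16169; 11231;
    152; 10080; 99; 65; 57; 2826; 114; 68; 69; 141; 9636; 87; 63; 48; 38; 397;
    47; 23; 47; 3497; 2550; 71; 87; 54; 56; 116; 28; 49; 61; 2106; 28; 122; 78;
    63; 37; 63; 67; 33; 56; 176; 183; 62; 11776; 109; 54; 78; 3138; 158; 109;
    72; 216; 13568; 9104; 115; 7665; 76; 52; 47; 2524; 91; 59; 54; 104; 217;
    120; 93; 61; 28; 9104; 120; 11776; 7665; 93; 115; 158; 91; 216; 104; 28;
    109; 72; 59; 54; 109; 76; 13568; 217; 54; 78; 3138; 52; 47; 2524; 61; 32;
    40; 70; 45; 39; 69; 74; 63; 33; 48; 71; 37; 56; 178; 197; 62; 32; 45; 1691;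
    40; 39; 438; 14140; 12558; 156; 48; 48; 23; 23; 62; 38; 47; 3597; 2965; 72;
    32; 45; 1691; 40; 39; 438; 14140; 12558; 156; 48; 48; 23; 23; 62; 38; 47;
    3597; 2965; 72; 32; 40; 70; 45; 39; 69; 74; 63; 33; 48; 71; 37; 56; 178;
    197; 62]%num.
(** The entries for height 5 are only approximations, with 15 decimals. *)
Definition denominator5 : N := 1000000000000000%num.
Definition values5 : seq N := [::
    27518284850793766; 20283466519803065; 362518554623220; 19559833377775295;
    189483365917912; 132735332605209; 56748033312704; 95854797399152;
    222654332060546; 48188569424065; 174465762636481; 4429370580055635;
    17901628774566138; 124487751680646; 75610860201166; 59747025596756;
    15863834604409; 29208148900923; 48876891479480; 9644884384571;
    39232007094909; 122051187392835; 123350226217853; 30297973048448;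
    123864354632632; 25420297072737; 98444057559894; 2199139522960480; 0;
    80449165766539; 43415188866093; 79468079250287; 0; 216079963145572;
    38711617620755; 16553607344727; 22158010276028; 453594037516359;
    177368345524817; 0; 177368345524817; 3820755122654177; 2845539035288948;
    81017502174244; 16816383622009354; 98467319687391; 55941095846120;
    42092198494422; 34213025666514; 7879172827907; 11275066257233;
    13848897351698; 4146795880705; 9702101470994; 30822129191961;
    34214370451346; 7552334618746; 42526223841271; 7535414612703;
    7535414612703; 0; 0; 34990809228568; 10373979306720; 24616829921848;
    111115103142746; 112391018885831; 11272789759065; 126578022158664;
    18175080089172; 8694624194670; 9480455894502; 19294022300729;
    9465279238664; 8873699286248; 591579952417; 631018615911; 94868818969306;
    21556398682618; 73312420286688; 1646403482860451; 0; 0; 0; 0; 0; 0; 0; 0;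
    57131363200037; 48518019733675; 8613343466362; 12442142935861; 0;
    37737455769269; 11389496973514; 26347958795755; 82930345530928; 0;
    93356965945120; 0; 20397038179825; 143720024412831; 22640315963383;
    10107468142888; 12532847820495; 246231675493192; 0; 121079708449448; 0;
    121079708449448; 2678855690028755; 0; 2012083570128693; 56724418597904; 0;
    107658177425692; 36061846987139; 57102394695567; 0; 0; 0; 0; 0; 0; 0; 0;
    266400254113655; 32739137283630; 11790953797087; 4891089810892;
    6899863986194; 130619308460635; 20948183486544; 0; 20948183486544;
    416012517245286; 307437738396891; 10757787229021; 233661116830025;
    394386634944; 394386634944; 0; 0; 233266730195080; 0; 233266730195080;
    5979275743929742; 4230889139074921; 87089640603108; 4056293443884938;
    54527706759592; 43224584840537; 11303121919054; 16316876598065;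
    63772093564476; 9767648665069; 54004444899407; 1389962630902495;
    27518284850793766; 20283466519803065; 362518554623220; 19559833377775295;
    222654332060546; 48188569424065; 174465762636481; 4429370580055635;
    189483365917912; 132735332605209; 56748033312704; 95854797399152;
    17901628774566138; 216079963145572; 38711617620755; 16553607344727;
    22158010276028; 453594037516359; 177368345524817; 0; 177368345524817;
    3820755122654177; 2845539035288948; 81017502174244; 123864354632632;
    80449165766539; 43415188866093; 79468079250287; 0; 25420297072737;
    98444057559894; 2199139522960480; 0; 124487751680646; 75610860201166;
    59747025596756; 15863834604409; 29208148900923; 48876891479480;
    9644884384571; 39232007094909; 122051187392835; 123350226217853;
    30297973048448; 16816383622009354; 266400254113655; 32739137283630;
    11790953797087; 4891089810892; 6899863986194; 130619308460635;
    20948183486544; 0; 20948183486544; 416012517245286; 307437738396891;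
    10757787229021; 233661116830025; 394386634944; 394386634944; 0; 0;
    233266730195080; 0; 233266730195080; 5979275743929742; 4230889139074921;
    87089640603108; 4056293443884938; 63772093564476; 9767648665069;
    54004444899407; 1389962630902495; 54527706759592; 43224584840537;
    11303121919054; 16316876598065; 143720024412831; 107658177425692;
    36061846987139; 57102394695567; 0; 0; 0; 0; 0; 0; 0; 0; 22640315963383;
    10107468142888; 12532847820495; 246231675493192; 0; 121079708449448; 0;
    121079708449448; 2678855690028755; 0; 2012083570128693; 0; 56724418597904;
    94868818969306; 57131363200037; 48518019733675; 8613343466362;
    12442142935861; 0; 37737455769269; 11389496973514; 26347958795755;
    82930345530928; 0; 93356965945120; 20397038179825; 0; 21556398682618;
    73312420286688; 1646403482860451; 0; 0; 0; 0; 0; 0; 0; 0; 98467319687391;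
    55941095846120; 42092198494422; 34213025666514; 7879172827907;
    11275066257233; 13848897351698; 4146795880705; 9702101470994;
    30822129191961; 34214370451346; 7552334618746; 42526223841271;
    7535414612703; 7535414612703; 0; 0; 34990809228568; 10373979306720;
    24616829921848; 111115103142746; 112391018885831; 11272789759065;
    126578022158664; 9465279238664; 8873699286248; 591579952417; 631018615911;
    18175080089172; 8694624194670; 9480455894502; 19294022300729;
    20231488328540051; 209522220100122; 28097250178876; 12726714575059;
    15370535603817; 303141796178154; 181424969921247; 0; 181424969921247;
    4039804174473623; 3037764996431198; 84281597667338; 131222335523839;
    87790131267813; 43432204256026; 112037877029187; 0; 28084606577659;
    103137728946180; 2365653553452491; 0; 132044650614907; 79427735923100;
    63505440631049; 15922295292051; 40850168233154; 52616914691807;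
    12439115809879; 40177798881928; 135251172432727; 153447576854971;
    22808938725958; 24725717295644109; 17995581934641899; 346391640743656;
    16568113792971528; 206047446528090; 40913265694439; 165134180833651;
    4025737016099948; 173607918922284; 125836733274617; 47771185647667;
    77116448321265; 14171292643632728; 188021186382116; 28113025865642;
    12038695222715; 16074330642927; 329523930101759; 159908160516474; 0;
    159908160516474; 3476808512838871; 2591299269122584; 72025083533331;
    105592853665585; 74238864511274; 31353989154311; 55723485681816; 0;
    20649227112280; 84943626553305; 1929366203741505; 0; 103347391954545;
    65474221359640; 54035579591384; 11438641768256; 20333256622220;
    37873170594904; 9644884384571; 28228286210333; 86402991777710;
    91671311309592; 22036717609658; 244662296940520; 200972922948569;
    235290227300240; 27629902119819; 0; 312430971101665; 1441846252584;
    26938276817244; 20949730206705; 0; 13739946642268; 0; 0; 0;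
    16330298929508808; 151430705974269; 24808180615015; 126622525359254;
    2893133836539834; 143101484573204; 100405871786014; 42695612787190;
    108450262877676; 22742482918800472; 16330298929508808; 333845747765067;
    14334125971914035; 192433574531124; 34910259149115; 157523315382009;
    3757727634575675; 161215285609182; 120686579788961; 40528705820221;
    63277436125639; 333845747765067; 20654951988724; 0; 175821875023232;
    143101484573204; 161215285609182; 19811234468821; 0; 186728492218171;
    108450262877676; 0; 63277436125639; 0; 0; 0; 0; 0; 0; 0; 0; 23773770845129;
    0; 116985402426485; 58836472596747; 100405871786014; 42695612787190;
    120686579788961; 40528705820221; 8392416317351; 11418818151470; 0; 0;
    181632088664418; 151430705974269; 192433574531124; 21162937301752; 0;
    22742482918800472; 181632088664418; 33477557428944; 148154531235474;
    3432368604691574; 175821875023232; 116985402426485; 58836472596747;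
    186728492218171; 33477557428944; 148154531235474; 3432368604691574;
    24808180615015; 126622525359254; 2893133836539834; 20654951988724;
    34910259149115; 157523315382009; 3757727634575675; 21162937301752;
    9308687600805; 11854249700947; 220954248442947; 19811234468821;
    8392416317351; 11418818151470; 23773770845129; 9308687600805;
    11854249700947; 220954248442947; 0; 0; 0; 16568113792971528;
    235290227300240; 20231488328540051; 14171292643632728; 312430971101665;
    10785901702570; 17298704875089; 48151302902648; 77004229565243;
    26133499380937; 63886574126539; 8317907005469; 12331320106811;
    24284991723603; 0; 65920957505804; 19022669047500; 31438493958213; 0;
    173607918922284; 132044650614907; 103347391954545; 75944556440928;
    63505440631049; 12439115809879; 17792805418016; 56100094173979;
    15922295292051; 40177798881928; 160039284091147; 164349388118147;
    23503903432022; 63680463975955; 54035579591384; 9644884384571;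
    13929131513530; 0; 39666927978589; 11438641768256; 28228286210333;
    87556565607380; 0; 97851778562512; 22068306914479; 0; 77116448321265; 0;
    153447576854971; 91671311309592; 0; 40913265694439; 165134180833651;
    4025737016099948; 27629902119819; 28084606577659; 103137728946180;
    2365653553452491; 20649227112280; 84943626553305; 1929366203741505;
    13739946642268; 125836733274617; 47771185647667; 206047446528090;
    79427735923100; 52616914691807; 131222335523839; 65474221359640;
    37873170594904; 105592853665585; 40850168233154; 135251172432727;
    112037877029187; 20333256622220; 0; 86402991777710; 0; 55723485681816; 0;
    0; 0; 63505440631049; 15922295292051; 12439115809879; 40177798881928;
    22808938725958; 0; 54035579591384; 11438641768256; 9644884384571;
    28228286210333; 22036717609658; 0; 87790131267813; 43432204256026;
    74238864511274; 31353989154311; 10785901702570; 77004229565243;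
    1881857846681439; 17298704875089; 26133499380937; 483795706771052;
    8317907005469; 65920957505804; 1563017653904003; 12213285904238;
    12331320106811; 19022669047500; 366348549837503; 1526660738030;
    209522220100122; 188021186382116; 22120748904515032; 236599270369198;
    19761479630659507; 300457230583411; 173906880351826; 12726714575059;
    12726714575059; 0; 0; 196795505525063; 15370535603817; 181424969921247;
    4182413801008563; 3350061806988926; 80949652694422; 12038695222715;
    12038695222715; 0; 0; 0; 175982491159401; 16074330642927; 159908160516474;
    3555284350546314; 28988487176820; 2948816671212148; 69089727843033;
    20600067482760; 24725717295644109; 244662296940520; 17995581934641899;
    200972922948569; 28097250178876; 303141796178154; 181424969921247;
    4039804174473623; 3037764996431198; 28113025865642; 329523930101759;
    1441846252584; 159908160516474; 3476808512838871; 26938276817244;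
    2591299269122584; 20949730206705; 346391640743656; 12726714575059;
    15370535603817; 0; 181424969921247; 84281597667338; 12038695222715;
    16074330642927; 0; 159908160516474; 72025083533331; 0; 0; 0; 4856430811739;
    5251037331149; 11130432593943; 5675375566644; 6857472253851;
    12501558916891; 0; 0; 0; 97126371047309; 23953337402138; 33470403184733;
    44223413853829; 12501004744075; 18319062056913; 11019909715080;
    6511765776713; 4508143938367; 9115460903485; 10536488967538; 0;
    10536488967538; 34478111547421; 30651971238611; 7817909411289;
    48887606992108; 42006253956962; 6881353035146; 11296246326829;
    24424813294580; 8613343466362; 15811469828218; 46942204636296;
    55087244229001; 12548251701490; 8317907005469; 17102390067268;
    34515129039129; 72131258761070; 26312798798825; 44952950211159;
    6511765776713; 0; 15044632905905; 35191755460941; 39610791290439;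
    50619597423324; 12442142935861; 22692822863364; 47738590069987;
    53746174654681; 6511765776713; 0; 4508143938367; 10536488967538;
    7846213389414; 42006253956962; 8613343466362; 6881353035146;
    15811469828218; 12550824790411; 56269215466642; 41748440279217;
    34213025666514; 7535414612703; 10877917732043; 14520775187425;
    4146795880705; 10373979306720; 32632908321003; 35951321751537;
    8124053872749; 42198104220749; 7879172827907; 7879172827907; 0; 0;
    34318931392841; 9702101470994; 24616829921848; 111089921609642;
    110422405490842; 11317822622899; 125210215020024; 9479007731833;
    8886569748593; 592437983240; 631933848789; 17573137544989; 8123793038127;
    9449344506862; 19367722649443; 69391909981328; 59747025596756;
    9644884384571; 13929131513530; 55095841699318; 15863834604409;
    39232007094909; 123755303617705; 138299347812024; 30358519216021;
    49627613107125; 42092198494422; 7535414612703; 10877917732043;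
    11275066257233; 0; 48839706580267; 13848897351698; 34990809228568;
    135077821591077; 133223959283459; 16943827108167; 136432744775326;
    18735883699474; 0; 41748440279217; 7879172827907; 16941987972899;
    14520775187425; 34318931392841; 18119208212273; 10531806378382;
    12108509585001; 23631991510834; 97126371047309; 23953337402138;
    33470403184733; 0; 0; 38359821547219; 34213025666514; 4146795880705;
    7312996110966; 17581274298901; 7879172827907; 9702101470994;
    29880674066705; 38452346199220; 7549868741864; 17909393919423;
    7535414612703; 10373979306720; 31796941612336; 24616829921848; 0;
    24616829921848; 87555760014222; 92329243808109; 10597193099389;
    59907516707188; 48518019733675; 11389496973514; 20411707230314;
    34961302262118; 8613343466362; 26347958795755; 81420316183717;
    85739215467611; 20366161112779; 0; 0; 0; 8317907005469; 72131258761070;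
    1694075645957625; 17102390067268; 26312798798825; 505063877002854;
    6511765776713; 50619597423324; 1227135661578096; 15044632905905;
    22692822863364; 419267821282355; 0; 0; 24736988116031622;
    21679418586838433; 317399218556310; 16553607344727; 16553607344727; 0; 0;
    199526355800846; 22158010276028; 177368345524817; 3906317611854969;
    3329699767587708; 77943315443407; 10107468142888; 10107468142888; 0; 0;
    133612556269943; 12532847820495; 121079708449448; 2770651423436178;
    2264685654959858; 54625645741287; 4891089810892; 4891089810892; 0; 0;
    27848047472738; 6899863986194; 20948183486544; 424456058361971;
    441073307053968; 10590176896722; 394386634944; 394386634944; 0; 0;
    233266730195080; 0; 233266730195080; 5123652150022259; 4727257473227234;
    74321797364765; 0; 0; 0; 6511765776713; 42006253956962; 1049177695707926;
    0; 8613343466362; 177957965870170; 4508143938367; 6881353035146;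
    129055770977395; 10536488967538; 15811469828218; 290212050304959;
    7846213389414; 12550824790411; 245553186445530; 0; 0; 0; 4856430811739;
    4856430811739; 0; 0; 102801746613953; 5675375566644; 97126371047309;
    2296157471857544; 1786782174686539; 42299538735263; 5251037331149;
    5251037331149; 0; 0; 30810809655990; 6857472253851; 23953337402138;
    474493951578634; 477903480273319; 12326107006024; 10531806378382;
    113820241369924; 97126371047309; 2217919834568863; 1669727911925690;
    12108509585001; 132411434123268; 23953337402138; 460935855459892;
    342355658203004; 4856430811739; 5675375566644; 0; 97126371047309;
    44223413853829; 5251037331149; 6857472253851; 0; 23953337402138;
    12501004744075; 25798673444132301; 20874881135443184; 271201307035755;
    19083994246245147; 283495268138244; 49045378038331; 234449890099913;
    5980144157056713; 176229140358533; 123028682786614; 53200457571919;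
    90810786161529; 5285476445837; 5285476445837; 4891089810892; 394386634944;
    420679077274; 0; 0; 0; 0; 0; 0; 261114777667818; 6899863986194;
    6899863986194; 0; 0; 254214913681624; 20948183486544; 233266730195080;
    5978882119824891; 4716728114349274; 79613333118155; 4505509993593356;
    75755584980652; 19746566177556; 56009018803096; 1355716461991523;
    52047547047671; 41451694508920; 10595852538752; 15338277648514;
    23495561445564615; 250098650778889; 22200038494399704; 16786100691603623;
    228093091700180; 12185340432031; 130619308460635; 0; 11790953797087;
    394386634944; 420679077274; 254214913681624; 5321680016892737;
    78263218923409; 20948183486544; 233266730195080; 4888657307351685;
    3706946783436856; 69405180919155; 274746437425688; 331302149697760;
    5285476445837; 6899863986194; 0; 0; 254214913681624; 80643976321086;
    86855416668037; 0; 0; 0; 6511765776713; 42006253956962; 1049177695707926;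
    0; 8613343466362; 177957965870170; 4508143938367; 6881353035146;
    129055770977395; 10536488967538; 15811469828218; 290212050304959;
    7846213389414; 12550824790411; 245553186445530; 4856430811739;
    4856430811739; 0; 0; 102801746613953; 5675375566644; 97126371047309;
    2296157471857544; 1786782174686539; 42299538735263; 5251037331149;
    5251037331149; 0; 0; 30810809655990; 6857472253851; 23953337402138;
    474493951578634; 477903480273319; 12326107006024; 10531806378382;
    113820241369924; 97126371047309; 2217919834568863; 1669727911925690;
    12108509585001; 132411434123268; 23953337402138; 460935855459892;
    342355658203004; 4856430811739; 5675375566644; 0; 97126371047309;
    44223413853829; 5251037331149; 6857472253851; 0; 23953337402138;
    12501004744075; 25798673444132301; 20874881135443184; 271201307035755;
    19083994246245147; 176229140358533; 123028682786614; 53200457571919;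
    90810786161529; 283495268138244; 49045378038331; 234449890099913;
    5980144157056713; 5285476445837; 5285476445837; 4891089810892;
    394386634944; 420679077274; 0; 0; 0; 0; 0; 0; 261114777667818;
    6899863986194; 6899863986194; 0; 0; 254214913681624; 20948183486544;
    233266730195080; 5978882119824891; 4716728114349274; 79613333118155;
    4505509993593356; 52047547047671; 41451694508920; 10595852538752;
    15338277648514; 75755584980652; 19746566177556; 56009018803096;
    1355716461991523; 22200038494399704; 23495561445564615; 250098650778889;
    16786100691603623; 228093091700180; 12185340432031; 11790953797087;
    394386634944; 420679077274; 130619308460635; 0; 254214913681624;
    20948183486544; 233266730195080; 4888657307351685; 5321680016892737;
    78263218923409; 3706946783436856; 69405180919155; 274746437425688;
    331302149697760; 0; 5285476445837; 6899863986194; 80643976321086; 0;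
    254214913681624; 86855416668037; 10531806378382; 12108509585001;
    23631991510834; 97126371047309; 23953337402138; 33470403184733; 0; 0;
    59907516707188; 48518019733675; 11389496973514; 20411707230314;
    34961302262118; 8613343466362; 26347958795755; 81420316183717;
    85739215467611; 20366161112779; 38359821547219; 34213025666514;
    4146795880705; 7312996110966; 17581274298901; 7879172827907; 9702101470994;
    29880674066705; 38452346199220; 7549868741864; 17909393919423;
    7535414612703; 10373979306720; 31796941612336; 24616829921848; 0;
    24616829921848; 87555760014222; 92329243808109; 10597193099389; 0; 0; 0;
    4856430811739; 5251037331149; 11130432593943; 5675375566644; 6857472253851;
    12501558916891; 0; 0; 0; 97126371047309; 23953337402138; 33470403184733;
    44223413853829; 12501004744075; 18319062056913; 0; 0; 0; 11019909715080;
    6511765776713; 4508143938367; 9115460903485; 10536488967538; 0;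
    10536488967538; 34478111547421; 30651971238611; 7817909411289;
    48887606992108; 42006253956962; 6881353035146; 11296246326829;
    24424813294580; 8613343466362; 15811469828218; 46942204636296;
    55087244229001; 12548251701490; 56269215466642; 41748440279217;
    34213025666514; 7535414612703; 10877917732043; 14520775187425;
    4146795880705; 10373979306720; 32632908321003; 35951321751537;
    8124053872749; 42198104220749; 7879172827907; 7879172827907; 0; 0;
    34318931392841; 9702101470994; 24616829921848; 111089921609642;
    110422405490842; 11317822622899; 125210215020024; 17573137544989;
    8123793038127; 9449344506862; 19367722649443; 9479007731833; 8886569748593;
    592437983240; 631933848789; 8317907005469; 72131258761070;
    1694075645957625; 17102390067268; 26312798798825; 505063877002854;
    6511765776713; 50619597423324; 1227135661578096; 0; 15044632905905;
    22692822863364; 419267821282355; 0; 24736988116031622; 21679418586838433;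
    317399218556310; 16553607344727; 16553607344727; 0; 0; 199526355800846;
    22158010276028; 177368345524817; 3906317611854969; 3329699767587708;
    77943315443407; 4891089810892; 4891089810892; 0; 0; 27848047472738;
    6899863986194; 20948183486544; 424456058361971; 441073307053968;
    10590176896722; 394386634944; 394386634944; 0; 0; 233266730195080; 0;
    233266730195080; 5123652150022259; 4727257473227234; 74321797364765;
    10107468142888; 10107468142888; 0; 0; 0; 133612556269943; 12532847820495;
    121079708449448; 2770651423436178; 0; 2264685654959858; 0; 54625645741287;
    8317907005469; 17102390067268; 34515129039129; 72131258761070;
    26312798798825; 44952950211159; 6511765776713; 6511765776713; 0; 0;
    15044632905905; 4508143938367; 10536488967538; 35191755460941;
    39610791290439; 7846213389414; 50619597423324; 42006253956962;
    8613343466362; 12442142935861; 22692822863364; 6881353035146;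
    15811469828218; 47738590069987; 53746174654681; 12550824790411;
    69391909981328; 59747025596756; 9644884384571; 13929131513530;
    55095841699318; 15863834604409; 39232007094909; 123755303617705;
    138299347812024; 30358519216021; 49627613107125; 41748440279217;
    7879172827907; 11275066257233; 0; 42092198494422; 7535414612703;
    10877917732043; 0; 48839706580267; 14520775187425; 34318931392841;
    133223959283459; 16943827108167; 13848897351698; 34990809228568;
    135077821591077; 16941987972899; 136432744775326; 18119208212273;
    18735883699474; 10785901702570; 77004229565243; 1881857846681439;
    17298704875089; 26133499380937; 483795706771052; 8317907005469;
    65920957505804; 1563017653904003; 12331320106811; 19022669047500;
    366348549837503; 12726714575059; 12726714575059; 0; 0; 196795505525063;
    15370535603817; 181424969921247; 4182413801008563; 3350061806988926;
    80949652694422; 22120748904515032; 19761479630659507; 300457230583411;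
    12038695222715; 12038695222715; 0; 0; 175982491159401; 16074330642927;
    159908160516474; 3555284350546314; 2948816671212148; 69089727843033;
    10785901702570; 17298704875089; 48151302902648; 77004229565243;
    26133499380937; 63886574126539; 8317907005469; 12331320106811;
    24284991723603; 65920957505804; 19022669047500; 31438493958213;
    75944556440928; 63505440631049; 12439115809879; 17792805418016;
    56100094173979; 15922295292051; 40177798881928; 160039284091147;
    164349388118147; 23503903432022; 63680463975955; 54035579591384;
    9644884384571; 13929131513530; 39666927978589; 11438641768256;
    28228286210333; 87556565607380; 97851778562512; 22068306914479;
    12213285904238; 1526660738030; 236599270369198; 173906880351826; 0;
    28988487176820; 20600067482760; 0; 0; 0; 0; 0]%num.
Definition weights5 : seq N := [::
    68511; 47348; 411; 44962; 320; 183; 171; 488; 265; 159; 140; 12385; 40454;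
    287; 161; 119; 77; 182; 159; 49; 144; 580; 542; 143; 201; 99; 136; 6322;
    46; 97; 138; 392; 46; 225; 147; 102; 79; 1484; 112; 34; 112; 9868; 7110;
    147; 38647; 295; 169; 127; 98; 62; 110; 76; 44; 66; 217; 221; 77; 160; 52;
    52; 34; 34; 142; 60; 116; 666; 575; 97; 644; 110; 68; 76; 170; 94; 88; 40;
    46; 210; 102; 142; 4972; 47; 43; 38; 45; 51; 46; 38; 46; 108; 91; 52; 92;
    41; 136; 59; 111; 460; 50; 473; 47; 122; 197; 113; 85; 62; 838; 41; 118;
    34; 118; 7255; 49; 5320; 154; 44; 116; 115; 325; 51; 46; 38; 46; 44; 40;
    38; 45; 190; 130; 98; 71; 62; 496; 66; 34; 66; 1281; 943; 80; 93; 41; 41;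
    34; 34; 86; 34; 86; 15393; 10269; 140; 9880; 129; 105; 58; 90; 101; 55; 79;
    3960; 68511; 47348; 411; 44962; 265; 159; 140; 12385; 320; 183; 171; 488;
    40454; 225; 147; 102; 79; 1484; 112; 34; 112; 9868; 7110; 147; 201; 97;
    138; 392; 46; 99; 136; 6322; 46; 287; 161; 119; 77; 182; 159; 49; 144; 580;
    542; 143; 38647; 190; 130; 98; 71; 62; 496; 66; 34; 66; 1281; 943; 80; 93;
    41; 41; 34; 34; 86; 34; 86; 15393; 10269; 140; 9880; 101; 55; 79; 3960;
    129; 105; 58; 90; 197; 116; 115; 325; 44; 40; 38; 45; 51; 46; 38; 46; 113;
    85; 62; 838; 41; 118; 34; 118; 7255; 49; 5320; 44; 154; 210; 108; 91; 52;
    92; 41; 136; 59; 111; 460; 50; 473; 122; 47; 102; 142; 4972; 51; 46; 38;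
    46; 47; 43; 38; 45; 295; 169; 127; 98; 62; 110; 76; 44; 66; 217; 221; 77;
    160; 52; 52; 34; 34; 142; 60; 116; 666; 575; 97; 644; 94; 88; 40; 46; 110;
    68; 76; 170; 47121; 255; 135; 101; 67; 1015; 155; 34; 155; 10882; 7987;
    211; 266; 152; 148; 583; 54; 121; 178; 7068; 54; 376; 223; 175; 81; 262;
    187; 65; 155; 691; 780; 131; 59675; 40585; 317; 36517; 202; 125; 111;
    10981; 245; 145; 134; 364; 30700; 167; 113; 82; 65; 1079; 88; 34; 88; 8861;
    6381; 120; 158; 86; 105; 283; 42; 83; 109; 5468; 42; 221; 131; 101; 64;
    138; 125; 49; 109; 413; 400; 111; 686; 385; 272; 135; 54; 206; 47; 124; 98;
    46; 94; 41; 50; 48; 36024; 197; 89; 142; 8136; 284; 186; 132; 487; 53810;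
    36024; 259; 30740; 162; 103; 93; 10086; 200; 124; 110; 283; 259; 124; 55;
    489; 284; 200; 107; 47; 984; 487; 55; 283; 43; 39; 38; 45; 47; 43; 38; 45;
    154; 45; 320; 202; 186; 132; 124; 110; 67; 74; 43; 38; 342; 197; 162; 100;
    43; 53810; 342; 137; 240; 10184; 489; 320; 202; 984; 137; 240; 10184; 89;
    142; 8136; 124; 103; 93; 10086; 100; 69; 64; 769; 107; 67; 74; 154; 69; 64;
    769; 39; 38; 45; 36517; 272; 47121; 30700; 206; 65; 91; 303; 121; 91; 313;
    47; 70; 156; 41; 73; 70; 161; 39; 245; 376; 221; 207; 175; 65; 108; 203;
    81; 155; 873; 845; 136; 116; 101; 49; 77; 37; 139; 64; 109; 423; 50; 459;
    111; 52; 364; 54; 780; 400; 48; 125; 111; 10981; 135; 121; 178; 7068; 83;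
    109; 5468; 94; 145; 134; 202; 223; 187; 266; 131; 125; 158; 262; 691; 583;
    138; 41; 413; 50; 283; 46; 54; 42; 175; 81; 65; 155; 131; 54; 101; 64; 49;
    109; 111; 42; 152; 148; 86; 105; 65; 121; 5442; 91; 91; 1676; 47; 73; 4294;
    82; 70; 70; 1207; 45; 255; 167; 51549; 499; 46908; 328; 498; 101; 101; 34;
    34; 188; 67; 155; 11312; 9090; 212; 82; 82; 34; 34; 34; 119; 65; 88; 9062;
    129; 7605; 121; 112; 59675; 686; 40585; 385; 135; 1015; 155; 10882; 7987;
    113; 1079; 47; 88; 8861; 124; 6381; 98; 317; 101; 67; 34; 155; 211; 82; 65;
    34; 88; 120; 43; 38; 45; 59; 60; 119; 44; 52; 101; 34; 34; 34; 81; 70; 200;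
    110; 78; 153; 64; 51; 46; 75; 72; 34; 72; 241; 209; 78; 86; 73; 46; 75; 90;
    52; 73; 251; 274; 77; 47; 86; 208; 84; 86; 218; 51; 34; 84; 240; 250; 91;
    92; 85; 254; 257; 51; 34; 46; 72; 79; 73; 52; 46; 73; 77; 153; 116; 98; 52;
    77; 71; 44; 60; 166; 176; 60; 176; 62; 62; 34; 34; 148; 66; 116; 675; 633;
    96; 726; 94; 87; 40; 46; 127; 85; 76; 161; 134; 119; 49; 77; 187; 77; 144;
    593; 645; 144; 145; 127; 52; 77; 110; 34; 184; 76; 142; 728; 778; 136; 698;
    114; 34; 116; 62; 136; 71; 148; 132; 69; 78; 186; 81; 70; 184; 41; 49; 108;
    98; 44; 67; 94; 62; 66; 213; 266; 77; 78; 52; 60; 160; 116; 34; 116; 501;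
    540; 91; 115; 91; 59; 116; 128; 52; 111; 459; 450; 121; 37; 50; 51; 47; 84;
    4691; 86; 86; 1665; 51; 91; 3562; 84; 85; 1456; 41; 50; 59409; 53044; 452;
    102; 102; 34; 34; 157; 79; 112; 10091; 8753; 148; 85; 85; 34; 34; 146; 62;
    118; 7531; 6206; 155; 71; 71; 34; 34; 94; 62; 66; 1306; 1422; 80; 41; 41;
    34; 34; 86; 34; 86; 12724; 11953; 126; 34; 50; 51; 51; 73; 3007; 34; 52;
    589; 46; 46; 441; 72; 73; 1064; 79; 77; 876; 40; 38; 45; 59; 59; 34; 34;
    91; 44; 81; 6098; 4725; 110; 60; 60; 34; 34; 89; 52; 70; 1467; 1515; 78;
    69; 388; 81; 5867; 4307; 78; 484; 70; 1422; 1048; 59; 44; 34; 81; 110; 60;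
    52; 34; 70; 78; 62751; 49167; 415; 45755; 308; 236; 106; 15382; 333; 178;
    189; 591; 77; 77; 71; 41; 48; 34; 34; 34; 34; 34; 34; 146; 62; 62; 34; 34;
    118; 66; 86; 15340; 11796; 138; 11481; 150; 102; 82; 3727; 131; 107; 58;
    96; 57220; 430; 52136; 38219; 301; 105; 496; 34; 98; 41; 48; 118; 13611;
    188; 66; 86; 12155; 8979; 114; 442; 304; 77; 62; 34; 34; 118; 182; 162; 40;
    38; 45; 51; 73; 3007; 34; 52; 589; 46; 46; 441; 72; 73; 1064; 79; 77; 876;
    59; 59; 34; 34; 91; 44; 81; 6098; 4725; 110; 60; 60; 34; 34; 89; 52; 70;
    1467; 1515; 78; 69; 388; 81; 5867; 4307; 78; 484; 70; 1422; 1048; 59; 44;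
    34; 81; 110; 60; 52; 34; 70; 78; 62751; 49167; 415; 45755; 333; 178; 189;
    591; 308; 236; 106; 15382; 77; 77; 71; 41; 48; 34; 34; 34; 34; 34; 34; 146;
    62; 62; 34; 34; 118; 66; 86; 15340; 11796; 138; 11481; 131; 107; 58; 96;
    150; 102; 82; 3727; 52136; 57220; 430; 38219; 301; 105; 98; 41; 48; 496;
    34; 118; 66; 86; 12155; 13611; 188; 8979; 114; 442; 304; 34; 77; 62; 182;
    34; 118; 162; 69; 78; 186; 81; 70; 184; 41; 49; 115; 91; 59; 116; 128; 52;
    111; 459; 450; 121; 108; 98; 44; 67; 94; 62; 66; 213; 266; 77; 78; 52; 60;
    160; 116; 34; 116; 501; 540; 91; 37; 50; 51; 59; 60; 119; 44; 52; 101; 34;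
    34; 34; 81; 70; 200; 110; 78; 153; 43; 38; 45; 64; 51; 46; 75; 72; 34; 72;
    241; 209; 78; 86; 73; 46; 75; 90; 52; 73; 251; 274; 77; 153; 116; 98; 52;
    77; 71; 44; 60; 166; 176; 60; 176; 62; 62; 34; 34; 148; 66; 116; 675; 633;
    96; 726; 127; 85; 76; 161; 94; 87; 40; 46; 47; 84; 4691; 86; 86; 1665; 51;
    91; 3562; 41; 84; 85; 1456; 50; 59409; 53044; 452; 102; 102; 34; 34; 157;
    79; 112; 10091; 8753; 148; 71; 71; 34; 34; 94; 62; 66; 1306; 1422; 80; 41;
    41; 34; 34; 86; 34; 86; 12724; 11953; 126; 85; 85; 34; 34; 34; 146; 62;
    118; 7531; 50; 6206; 51; 155; 47; 86; 208; 84; 86; 218; 51; 51; 34; 34; 84;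
    46; 72; 240; 250; 79; 91; 73; 52; 92; 85; 46; 73; 254; 257; 77; 134; 119;
    49; 77; 187; 77; 144; 593; 645; 144; 145; 116; 62; 110; 34; 127; 52; 77;
    34; 184; 71; 148; 778; 136; 76; 142; 728; 136; 698; 132; 114; 65; 121;
    5442; 91; 91; 1676; 47; 73; 4294; 70; 70; 1207; 101; 101; 34; 34; 188; 67;
    155; 11312; 9090; 212; 51549; 46908; 328; 82; 82; 34; 34; 119; 65; 88;
    9062; 7605; 121; 65; 91; 303; 121; 91; 313; 47; 70; 156; 73; 70; 161; 207;
    175; 65; 108; 203; 81; 155; 873; 845; 136; 116; 101; 49; 77; 139; 64; 109;
    423; 459; 111; 82; 45; 499; 498; 34; 129; 112; 41; 39; 37; 50; 52]%num.
(** The words are recomputed by [keys], so the tables hold numbers only; a misaligned or truncated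
    table can at worst make a check fail. *)
Definition tabulate h (xs ys : seq N) : certificate := zip (keys h) (zip xs ys).

Lemma certified3 : exact_check 3 denominator3 9 10
  (tabulate 3 values3 weights3) 486414801 25317287.
Proof. by vm_compute. Qed.

Lemma certified4 : exact_check 4 denominator4 9 10 (tabulate 4 values4 weights4)
  36398762646457399797278201924184927631185786219507599165631529
  1584271961568506676402164217848452838298247680057676502545715.
Proof. by vm_compute. Qed.

(** The constant 98 is the allowance for the defect of the approximate entries, in units of Y / (6^5
    * 10^15); the rate 9/10 turns it into an error ten times as large. *)
Lemma certified5 : round_check 5 denominator5 9 10 98
  (tabulate 5 values5 weights5) 10 265182848508.
Proof. by vm_compute. Qed.

(* The numerals are binary (N, coerced to nat by nat_of_bin): as ring or nat
   numerals they would be unary. *)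
Theorem mainTheorem6 (R : realType) :
  [/\ L R 3 = (486414801%num%:R / 25317287%num%:R)%:E,
      L R 4 =
        (36398762646457399797278201924184927631185786219507599165631529%num%:R
         / 1584271961568506676402164217848452838298247680057676502545715%num%:R
        )%:E
    & exists q : rat,
        L R 5 = (ratr q)%:E /\
        round_dec 10 q = 265182848508%num%:R / 10 ^+ 10].
Proof.
split; [exact: exact_checkP certified3|exact: exact_checkP certified4|].
exact: round_checkP certified5.
Qed.
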